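(* Let $g\ge 0$. The category $\mathrm{Cone}(\mathbf{Quiver}_{\le g})^{\mathrm{op}}$ is quasi-Gröbner. In particular, for every Noetherian commutative ring $R$ with identity, subrepresentations of finitely generated representations of $\mathrm{Cone}(\mathbf{Quiver}_{\le g})^{\mathrm{op}}$ over $R$ are also finitely generated.
   Context: A (finite) quiver $Q$ consists of finite sets $V(Q)$ (vertices), $E(Q)$ (edges) and maps $s,t\colon E(Q)\to V(Q)$ (source, target). Its geometric realization $|Q|$ is the 1-dimensional CW complex with a 0-cell for each vertex and a 1-cell for each edge. $Q$ is connected if $|Q|$ is; the genus of $Q$ is the first Betti number of $|Q|$; a directed tree is a quiver with contractible geometric realization. A minor morphism $\phi\colon Q'\to Q$ is a map of sets $\phi\colon V(Q')\sqcup E(Q')\sqcup\{\star\}\to V(Q)\sqcup E(Q)\sqcup\{\star\}$ such that: (1) $\phi(V(Q'))=V(Q)$ and $\phi(\star)=\star$; (2) if $e\in E(Q')$ and $\phi(e)\ne\star$, then either $\phi(e)=\phi(s(e))=\phi(t(e))$ is a vertex of $Q$, or $\phi(e)$ is an edge of $Q$ with source $\phi(s(e))$ and target $\phi(t(e))$; (3) $\phi$ restricts to a bijection $\phi^{-1}(E(Q))\to E(Q)$; (4) for each vertex $v$ of $Q$, the preimage $\phi^{-1}(v)$, regarded as a subquiver of $Q'$, is a directed tree. Edges sent to $\star$ are deleted; edges sent to vertices are contracted. Only deletions with connected result are allowed. Cones. A cone over a quiver $G$, denoted $\mathrm{Cone}(G)$, is a quiver obtained by adding a new vertex (the cone point)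 to $G$ and, for each vertex $v$ of $G$, exactly one edge (in either direction) between the cone point and $v$. A base contraction $\mathrm{Cone}(G)\to\mathrm{Cone}(G')$ is a minor morphism that contracts edges of $G\subseteq\mathrm{Cone}(G)$ and then deletes newly created multiple edges at the cone point, so that exactly one edge joins the cone point to each vertex of $G'$. A base deletion is a minor morphism $\mathrm{Cone}(G)\to\mathrm{Cone}(G')$ that deletes edges of $G\subseteq\mathrm{Cone}(G)$. A base minor morphism is a minor morphism that is a composition of base contractions and base deletions. $\mathrm{Cone}(\mathbf{Quiver}_{\le g})$ is the category whose objects are cones over connected finite quivers $G$ of genus at most $g$ (so it is the base $G$ that has genus at most $g$) and whose morphisms are base minor morphisms. Gröbner and quasi-Gröbner categories. Let $\mathbf{C}$ be an essentially small category. - For a functor $\mathbf S\colon\mathbf C\to\mathbf{Set}$, let $\widetilde{\mathbf S}=\bigsqcup_{c}\mathbf S(c)$; for $f\in\mathbf S(c)$, $f'\in\mathbf S(c')$ put $f\le f'$ if there is $h\colon c\to c'$ with $\mathbf S(h)(f)=f'$. The poset $|\mathbf S|$ is the quotient of $\widetilde{\mathbf S}$ by the relation ($f\le f'$ and $f'\le f$), with the induced order. - $\mathbf S$ is orderable if one can choose a well-order on each $\mathbf S(c)$ such that for every morphism $c\to c'$ the map $\mathbf S(c)\to\mathbf S(c')$ is strictly order-preserving. - A poset $P$ is Noetherian if for every infinite sequence $x_1,x_2,\dots$ in $P$ there are $i<j$ with $x_i\le x_j$. - $\mathbf C$ is Gröbner if for every object $c$ the functor $\mathbf S_c=\mathrm{Hom}_{\mathbf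 C}(c,-)$ is orderable and $|\mathbf S_c|$ is Noetherian. - A functor $F\colon\mathbf C\to\mathbf D$ satisfies property (F) if for every object $d$ of $\mathbf D$ there are finitely many objects $c_1,\dots,c_n$ of $\mathbf C$ and morphisms $\delta_i\colon d\to F(c_i)$ such that for every object $c$ of $\mathbf C$ and every morphism $\delta\colon d\to F(c)$ there are an index $i$ and a morphism $\gamma_i\colon c_i\to c$ with $\delta=F(\gamma_i)\circ\delta_i$. - $\mathbf C$ is quasi-Gröbner if there exist a Gröbner category $\widetilde{\mathbf C}$ and an essentially surjective functor $\widetilde{\mathbf C}\to\mathbf C$ satisfying property (F). A representation of $\mathbf C$ over $R$ is a functor $\mathcal M\colon\mathbf C\to R\textbf{-Mod}$; a subrepresentation is a subfunctor with values $R$-submodules. $\mathcal M$ is finitely generated if there is a finite subset $S\subseteq\bigoplus_{c}\mathcal M(c)$ such that the smallest subrepresentation of $\mathcal M$ containing $S$ is $\mathcal M$. *)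

(* Defs.v *)
From mathcomp Require Import all_boot all_order all_algebra.
From mathcomp Require Import boolp.
From mathcomp Require wochoice.

Set Implicit Arguments.
Unset Strict Implicit.
Unset Printing Implicit Defensive.

Import GRing.Theory.

(** * Quivers *)

Record quiver := Quiver {
  qvert : finType;
  qedge : finType;
  src : qedge -> qvert;
  tgt : qedge -> qvert
}.

Section Topology.
Variable Q : quiver.

Definition adjacent : rel (qvert Q) := fun x y =>
  [exists e : qedge Q, ((src e == x) && (tgt e == y))
                    || ((src e == y) && (tgt e == x))].

(* |Q| is a CW complex, so it is connected iff it is nonempty and any two
   0-cells are joined by an edge path; the empty quiver is not connected. *)
Definition qconnected : Prop :=
  0 < #|qvert Q| /\ forall x y : qvert Q, connect adjacent x y.

(* The cellular boundary map Q^E -> Q^V of |Q|, acting on row vectors: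
   an edge e is sent to tgt e - src e. *)
Definition boundary : 'M[rat]_(#|qedge Q|, #|qvert Q|) :=
  (\matrix_(i, j) ((tgt (enum_val i) == enum_val j)%:R
                   - (src (enum_val i) == enum_val j)%:R))%R.

(* There are no 2-cells, so H_1(|Q|; Q) is the kernel of the boundary map. *)
Definition genus : nat := \rank (kermx boundary).

(* A 1-dimensional CW complex is contractible iff it is connected (hence
   nonempty) and its first homology vanishes. *)
Definition directed_tree : Prop := qconnected /\ genus = 0.

Variables (A : {set qvert Q}) (B : {set qedge Q}).

Definition subvert := {x : qvert Q | x \in A}.
Definition subedge :=
  {e : qedge Q | [&& e \in B, src e \in A & tgt e \in A]}.

Lemma subedge_src (e : subedge) : src (val e) \in A.
Proof. by case/and3P: (valP e). Qed.

Lemma subedge_tgt (e : subedge) : tgt (val e) \in A.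
Proof. by case/and3P: (valP e). Qed.

(* Edges of B with an endpoint outside A are discarded; this makes the
   definition total and discards nothing when A, B do form a subquiver. *)
Definition subquiver : quiver :=
  @Quiver subvert subedge
    (fun e => exist _ (src (val e)) (subedge_src e))
    (fun e => exist _ (tgt (val e)) (subedge_tgt e)).

End Topology.

(** * Minor morphisms *)

(* V(Q) + E(Q) + {star}, with None as star. *)
Definition cell (Q : quiver) : finType := option (qvert Q + qedge Q)%type.

Definition cvert (Q : quiver) (x : qvert Q) : cell Q := Some (inl x).
Definition cedge (Q : quiver) (e : qedge Q) : cell Q := Some (inr e).
Definition star (Q : quiver) : cell Q := None.

Definition vertices (Q : quiver) : {set cell Q} :=
  [set cvert x | x in [set: qvert Q]]%SET.
Definition edges (Q : quiver) : {set cell Q} :=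
  [set cedge e | e in [set: qedge Q]]%SET.

Definition cellmap (Q' Q : quiver) := {ffun cell Q' -> cell Q}.

Definition cm_id (Q : quiver) : cellmap Q Q := [ffun c => c].
Definition cm_comp (Q1 Q2 Q3 : quiver) (g : cellmap Q2 Q3)
  (f : cellmap Q1 Q2) : cellmap Q1 Q3 := [ffun c => g (f c)].

Section Minor.
Variables (Q' Q : quiver) (phi : cellmap Q' Q).

Definition deleted (e : qedge Q') : Prop := phi (cedge e) = star Q.
Definition contracted (e : qedge Q') : Prop :=
  exists v : qvert Q, phi (cedge e) = cvert v.

Definition fiber (v : qvert Q) : quiver :=
  subquiver [set x : qvert Q' | phi (cvert x) == cvert v]%SET
            [set e : qedge Q' | phi (cedge e) == cvert v]%SET.

Record minor : Prop := Minor {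
  minor_vert : phi @: vertices Q' = vertices Q;
  minor_star : phi (star Q') = star Q;
  minor_edge : forall e : qedge Q', phi (cedge e) <> star Q ->
    (exists v : qvert Q, [/\ phi (cedge e) = cvert v,
        phi (cvert (src e)) = cvert v & phi (cvert (tgt e)) = cvert v])
    \/ (exists f : qedge Q, [/\ phi (cedge e) = cedge f,
        phi (cvert (src e)) = cvert (src f)
        & phi (cvert (tgt e)) = cvert (tgt f)]);
  minor_inj : {in phi @^-1: edges Q &, injective phi};
  minor_surj : phi @: (phi @^-1: edges Q) = edges Q;
  minor_tree : forall v : qvert Q, directed_tree (fiber v)
}.

End Minor.

(** * Cones *)

(* A cone over G is G together with a direction for each cone edge; the
   direction is true when the edge goes from the cone point to the base. *)
Record cone := Cone {
  base : quiver;
  cone_dir : {ffun qvert base -> bool}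
}.

Definition cone_src (X : cone) (e : qedge (base X) + qvert (base X)) :
    option (qvert (base X)) :=
  match e with
  | inl e => Some (src e)
  | inr v => if cone_dir X v then None else Some v
  end.

Definition cone_tgt (X : cone) (e : qedge (base X) + qvert (base X)) :
    option (qvert (base X)) :=
  match e with
  | inl e => Some (tgt e)
  | inr v => if cone_dir X v then Some v else None
  end.

Definition cone_quiver (X : cone) : quiver :=
  @Quiver (option (qvert (base X))) (qedge (base X) + qvert (base X))%type
    (@cone_src X) (@cone_tgt X).

Coercion cone_quiver : cone >-> quiver.

Definition cone_point (X : cone) : qvert X := None.
Definition base_edge (X : cone) (e : qedge (base X)) : qedge X := inl e.
Definition cone_edge (X : cone) (v : qvert (base X)) : qedge X := inr v.

(* Edges of the base are contracted or kept, and cone edges are deleted or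
   kept. Since the target is a cone, exactly one of the cone edges over each
   vertex of its base is kept. *)
Definition base_contraction (X Y : cone) (phi : cellmap X Y) : Prop :=
  [/\ minor phi,
      phi (cvert (cone_point X)) = cvert (cone_point Y),
      forall e : qedge (base X), ~ deleted phi (base_edge e)
    & forall v : qvert (base X), ~ contracted phi (cone_edge v)].

Definition base_deletion (X Y : cone) (phi : cellmap X Y) : Prop :=
  [/\ minor phi,
      phi (cvert (cone_point X)) = cvert (cone_point Y),
      forall e : qedge X, ~ contracted phi e
    & forall v : qvert (base X), ~ deleted phi (cone_edge v)].

(* Minor morphisms compose, so that every base minor morphism is one. The
   identity is a base contraction (and a base deletion). *)
Inductive base_minor : forall X Y : cone, cellmap X Y -> Prop :=
| Base_contraction (X Y : cone) (phi : cellmap X Y) :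
    base_contraction phi -> base_minor phi
| Base_deletion (X Y : cone) (phi : cellmap X Y) :
    base_deletion phi -> base_minor phi
| Base_comp (X Y Z : cone) (psi : cellmap Y Z) (phi : cellmap X Y) :
    base_minor psi -> base_minor phi -> base_minor (cm_comp psi phi).

Lemma fiber_id_tree (Q : quiver) (v : qvert Q) :
  directed_tree (fiber (cm_id Q) v).
Proof.
set F := fiber _ _.
have vF : v \in [set x : qvert Q | cm_id Q (cvert x) == cvert v]%SET.
  by rewrite inE ffunE.
have Fv (x : qvert F) : x = exist _ v vF.
  by apply: val_inj => /=; case: x => x /=; rewrite inE ffunE => /eqP[].
have E0 : #|qedge F| = 0.
  apply: eq_card0 => -[e /= He]; exfalso.
  by move: He; rewrite inE ffunE.
split; first split.
- by apply/card_gt0P; exists (exist _ v vF).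
- by move=> x y; rewrite (Fv x) (Fv y) connect0.
- by apply/eqP; rewrite /genus -leqn0 -E0 rank_leq_row.
Qed.

Lemma minor_id (Q : quiver) : minor (cm_id Q).
Proof.
have im (A : {set cell Q}) : (cm_id Q @: A = A)%SET.
  apply/setP=> x; apply/imsetP/idP => [[y yA ->]|xA]; first by rewrite ffunE.
  by exists x; rewrite ?ffunE.
split=> //.
- by rewrite ffunE.
- by move=> e _; right; exists e; rewrite !ffunE.
- by move=> x y _ _; rewrite !ffunE.
- rewrite im; apply/setP=> x; by rewrite inE ffunE.
- exact: fiber_id_tree.
Qed.

Lemma base_minor_id (X : cone) : base_minor (cm_id X : cellmap X X).
Proof.
apply: Base_contraction; split; first exact: minor_id.
- by rewrite ffunE.
- by move=> e; rewrite /deleted ffunE.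
- by move=> v [w]; rewrite ffunE.
Qed.

(** * Categories *)

(* [mcomp g f] is g after f. *)
Record category := Category {
  obj :> Type;
  arrow : obj -> obj -> Type;
  id_arrow : forall x, arrow x x;
  mcomp : forall x y z, arrow y z -> arrow x y -> arrow x z;
  comp1m : forall x y (f : arrow x y), mcomp (id_arrow y) f = f;
  compm1 : forall x y (f : arrow x y), mcomp f (id_arrow x) = f;
  compA : forall x y z w (h : arrow z w) (g : arrow y z) (f : arrow x y),
    mcomp h (mcomp g f) = mcomp (mcomp h g) f
}.
Arguments id_arrow {c} x.

Definition op (C : category) : category :=
  @Category C (fun x y => @arrow C y x) (fun x => id_arrow x)
    (fun x y z g f => mcomp f g)
    (fun x y f => compm1 f) (fun x y f => comp1m f)
    (fun x y z w h g f => esym (compA f g h)).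

Definition isomorphic (C : category) (x y : C) : Prop :=
  exists (f : arrow x y) (g : arrow y x), mcomp g f = id_arrow x /\ mcomp f g = id_arrow y.

(* The isomorphism classes are indexed by a small type, smallness being
   membership in the lowest universe. *)
Definition essentially_small (C : category) : Prop :=
  exists (I : Set) (r : I -> C), forall x : C, exists i, isomorphic (r i) x.

Record functor (C D : category) := Functor {
  fobj :> C -> D;
  fmap : forall x y : C, arrow x y -> arrow (fobj x) (fobj y);
  fmap1 : forall x : C, fmap (id_arrow x) = id_arrow (fobj x);
  fmapM : forall (x y z : C) (g : arrow y z) (f : arrow x y),
    fmap (mcomp g f) = mcomp (fmap g) (fmap f)
}.

Record set_functor (C : category) := SetFunctor {
  sobj :> C -> Type;
  smap : forall x y : C, arrow x y -> sobj x -> sobj y;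
  smap1 : forall (x : C) (s : sobj x), smap (id_arrow x) s = s;
  smapM : forall (x y z : C) (g : arrow y z) (f : arrow x y) (s : sobj x),
    smap (mcomp g f) s = smap g (smap f s)
}.

Definition hom_functor (C : category) (c : C) : set_functor C :=
  @SetFunctor C (fun x => arrow c x) (fun x y h f => mcomp h f)
    (fun x f => comp1m f)
    (fun x y z g f s => esym (compA g f s)).

(** * Groebner categories *)

Section Poset.
Variables (C : category) (S : set_functor C).

Definition elements := {c : C & S c}.

Definition elt_le (f f' : elements) : Prop :=
  exists h : arrow (tag f) (tag f'), smap h (tagged f) = tagged f'.

Definition elt_class (f : elements) : elements -> Prop :=
  fun f' => elt_le f f' /\ elt_le f' f.

(* The underlying set of |S|: the classes for the relation
   "f <= f' and f' <= f". *)
Definition poset_of := {A : elements -> Prop | exists f, A = elt_class f}.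

Definition poset_le (A B : poset_of) : Prop :=
  exists f f', [/\ sval A f, sval B f' & elt_le f f'].

Definition strictly_monotone (T T' : Type) (le : rel T) (le' : rel T')
    (f : T -> T') : Prop :=
  forall x y, le x y -> x <> y -> le' (f x) (f y) /\ f x <> f y.

Definition orderable : Prop :=
  exists le : forall c : C, rel (S c),
    (forall c, wochoice.well_order (le c)) /\
    (forall (c c' : C) (h : arrow c c'),
       strictly_monotone (le c) (le c') (smap h)).

End Poset.

Definition noetherian_poset (P : Type) (le : P -> P -> Prop) : Prop :=
  forall x : nat -> P, exists i j : nat, i < j /\ le (x i) (x j).

Definition groebner (C : category) : Prop :=
  essentially_small C /\
  forall c : C, orderable (hom_functor c) /\
                noetherian_poset (@poset_le C (hom_functor c)).

Definition property_F (C D : category) (F : functor C D) : Prop :=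
  forall d : D, exists (n : nat) (c : 'I_n -> C)
    (delta : forall i, arrow d (F (c i))),
    forall (x : C) (f : arrow d (F x)),
      exists (i : 'I_n) (gamma : arrow (c i) x),
        f = mcomp (fmap F gamma) (delta i).

Definition essentially_surjective (C D : category) (F : functor C D) : Prop :=
  forall d : D, exists c : C, isomorphic (F c) d.

(* Essential smallness of C follows from that of C'. *)
Definition quasi_groebner (C : category) : Prop :=
  exists (C' : category) (F : functor C' C),
    [/\ groebner C', essentially_surjective F & property_F F].

(** * Representations *)

(* The library's [set] and [finite_set] constrain the universe of their carrier
   to lie below that of [finType], which excludes types of quivers. *)
Definition finite_subset (T : Type) (A : T -> Prop) : Prop :=
  exists (n : nat) (x : 'I_n -> T), forall t, A t -> exists i, t = x i.

Definition noetherian_ring (R : comPzRingType) : Prop :=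
  forall I : {pred R^o}, submod_closed I ->
    exists (n : nat) (a : 'I_n -> R), forall x : R,
      x \in I <-> exists r : 'I_n -> R, x = (\sum_(i < n) r i * a i)%R.

Record representation (R : comPzRingType) (C : category) := Representation {
  robj :> C -> lmodType R;
  rmap : forall x y : C, arrow x y -> {linear robj x -> robj y};
  rmap1 : forall (x : C) (m : robj x), rmap (id_arrow x) m = m;
  rmapM : forall (x y z : C) (g : arrow y z) (f : arrow x y) (m : robj x),
    rmap (mcomp g f) m = rmap g (rmap f m)
}.

Record subrep (R : comPzRingType) (C : category) (M : representation R C) :=
  Subrep {
    subobj :> forall c : C, {pred M c};
    subobj_closed : forall c : C, submod_closed (@subobj c);
    subobj_map : forall (x y : C) (h : arrow x y) (m : M x),
      m \in @subobj x -> rmap M h m \in @subobj y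
  }.

Section FiniteGeneration.
Variables (R : comPzRingType) (C : category) (M : representation R C).

(* The direct sum of the modules M c over all objects c. *)
Definition dsum :=
  {m : forall c : C, M c | finite_subset (fun c : C => m c <> 0%R)}.

(* The submodule \bigoplus_c N c contains m. *)
Definition subrep_mem (N : subrep M) (m : dsum) : Prop :=
  forall c : C, sval m c \in N c.

Definition smallest_containing (S : dsum -> Prop) (N : subrep M) : Prop :=
  (forall m, S m -> subrep_mem N m) /\
  (forall N' : subrep M, (forall m, S m -> subrep_mem N' m) ->
     forall c : C, {subset N c <= N' c}).

(* Subrepresentations of N are the subrepresentations of M contained in N, so
   this says that N is finitely generated as a representation. *)
Definition subrep_finitely_generated (N : subrep M) : Prop :=
  exists S : dsum -> Prop, finite_subset S /\ smallest_containing S N.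

Lemma full_closed (c : C) : submod_closed (predT : {pred M c}).
Proof. by split. Qed.

Definition full_subrep : subrep M :=
  @Subrep R C M (fun c => predT) full_closed (fun _ _ _ _ _ => erefl).

Definition finitely_generated : Prop :=
  subrep_finitely_generated full_subrep.

End FiniteGeneration.

(** * The category of cones over connected quivers of genus at most g *)

Section ConeCategory.
Variable g : nat.

Record cone_le := ConeLe {
  cone_of : cone;
  cone_le_connected : qconnected (base cone_of);
  cone_le_genus : genus (base cone_of) <= g
}.

Definition cone_hom (X Y : cone_le) :=
  {phi : cellmap (cone_of X) (cone_of Y) | base_minor phi}.

Definition cone_id (X : cone_le) : cone_hom X X :=
  exist _ (cm_id (cone_of X)) (base_minor_id (cone_of X)).

Definition cone_comp (X Y Z : cone_le) (h : cone_hom Y Z) (f : cone_hom X Y) :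
    cone_hom X Z :=
  exist _ (cm_comp (sval h) (sval f)) (Base_comp (svalP h) (svalP f)).

Lemma cone_hom_inj (X Y : cone_le) (f h : cone_hom X Y) :
  sval f = sval h -> f = h.
Proof.
case: f h => [f Hf] [h Hh] /= E; subst h.
by rewrite (Prop_irrelevance Hf Hh).
Qed.

Lemma cone_comp1m (X Y : cone_le) (f : cone_hom X Y) :
  cone_comp (cone_id Y) f = f.
Proof. by apply: cone_hom_inj; apply/ffunP=> c; rewrite !ffunE. Qed.

Lemma cone_compm1 (X Y : cone_le) (f : cone_hom X Y) :
  cone_comp f (cone_id X) = f.
Proof. by apply: cone_hom_inj; apply/ffunP=> c; rewrite !ffunE. Qed.

Lemma cone_compA (X Y Z W : cone_le) (k : cone_hom Z W) (h : cone_hom Y Z)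
    (f : cone_hom X Y) :
  cone_comp k (cone_comp h f) = cone_comp (cone_comp k h) f.
Proof. by apply: cone_hom_inj; apply/ffunP=> c; rewrite !ffunE. Qed.

Definition ConeQuiver : category :=
  @Category cone_le cone_hom cone_id cone_comp
    cone_comp1m cone_compm1 cone_compA.

End ConeCategory.

(* Main.v *)
(* An object of the covering category is a rooted tree numbered in depth-first
   order, with at most g additional edges attached to its vertices; a morphism
   T -> U is an increasing map h of vertices that preserves and reflects the
   ancestor relation and preserves all decorations. Such an h has a right adjoint
   for the ancestor orders, x |-> the closest ancestor of x in the image of h,
   which contracts U onto T while the additional edges survive; keeping the cone
   edges at the image of h gives a base contraction Cone U -> Cone T.

   Orderability: h is a strictly increasing map, so Hom(T, -) is ordered
   lexicographically. Noetherianity: marking the image of h turns Hom(T, -) into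
   trees with finitely many labels, and Kruskal's theorem applies. Essential
   surjectivity: a connected quiver of genus at most g is a depth-first numbered
   spanning tree plus genus-many edges. Property (F): a base minor morphism
   Cone T -> Y contracts all but at most g + |V(Y)| - 1 edges of the tree T, so
   it factors through the tree induced on a set of vertices whose size is bounded
   in terms of g and Y.

   Noetherianity of representations is the Groebner basis argument: filter by the
   generators and compare ideals of leading coefficients. *)

Require Import Defs.
From mathcomp Require Import all_boot all_order all_algebra.
From mathcomp Require Import boolp zify.
From mathcomp Require wochoice.

Set Implicit Arguments.
Unset Strict Implicit.
Unset Printing Implicit Defensive.

Import GRing.Theory.

(** * Well-quasi-orders *)

(** The functor from trees reaches only contractions that keep all additional edges. Deletions of
    base edges are never lifted: property (F) absorbs them into the finitely many morphisms [delta].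
    So the additional edges can stay frozen in g numbered slots, and as their ends are always images
    of vertices of the source tree, the labels in Kruskal's theorem can ignore them.

    On the side of quivers the obstacle is that base minor morphisms are a closure under
    composition, with a condition on each fiber. A normal form replaces both: maps on vertices and
    edges of the bases, and a section telling which cone edges survive. That fibers are trees
    becomes their connectedness plus one global count, the sum of Euler characteristics. In this
    form minor morphisms compose, and they cancel on the right, which gives the factorizations.

    On the algebraic side generators are added one at a time modulo the span of the others, so each
    step compares monomials of a single functor Hom(c, -) and no free representation is built. *)

Section History.
Variables (T : Type) (next : seq T -> T).

(** Dependent choice in which a term may depend on all earlier ones; it serves both the minimal bad
    sequence and the choice of leading terms in [lead_basis]. *)
Fixpoint history (n : nat) : seq T :=
  if n is n'.+1 then rcons (history n') (next (history n')) else [::].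

Lemma history_In m n : m < n -> List.In (next (history m)) (history n).
Proof.
elim: n => // n IH; rewrite ltnS leq_eqVlt /= -cats1 => mn.
apply/List.in_app_iff; case/orP: mn => [/eqP->|/IH]; last by left.
by right; left.
Qed.

End History.

Definition good (T : Type) (le : T -> T -> Prop) (x : nat -> T) : Prop :=
  exists i j : nat, i < j /\ le (x i) (x j).

Definition wqo (T : Type) (le : T -> T -> Prop) : Prop :=
  forall x : nat -> T, good le x.

Definition increasing (k : nat -> nat) : Prop := forall i, k i < k i.+1.

Lemma increasing_ltn k i j : increasing k -> i < j -> k i < k j.
Proof.
move=> incr; elim: j => // j IH; rewrite ltnS leq_eqVlt => /orP[/eqP->//|/IH].
by move/ltn_trans; apply.
Qed.

Lemma increasing_choice (P : nat -> nat -> Prop) (p : nat) :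
  (forall n, p <= n -> exists2 m, n < m & P n m) ->
  exists k, [/\ increasing k, p <= k 0 & forall i, P (k i) (k i.+1)].
Proof.
move=> H; have [f Hf] : {f : nat -> nat & forall n, p <= n -> n < f n /\ P n (f n)}.
  apply: (@choice _ _ (fun n m => p <= n -> n < m /\ P n m)) => n.
  case: (leqP p n) => pn; last by exists 0.
  by have [m ? ?] := H n pn; exists m.
exists (fun i => iter i f p); have ge i : p <= iter i f p.
  by elim: i => //= i IH; apply: (leq_trans IH); case: (Hf _ IH) => /ltnW.
by split=> // i; case: (Hf _ (ge i)).
Qed.

Section Wqo.
Variables (T : Type) (le : T -> T -> Prop).
Hypothesis le_trans : forall x y z, le x y -> le y z -> le x z.

(* Only finitely many terms lie below no later term; past them, always pass to
   a later larger term. *)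
Lemma good_monotone (x : nat -> T) :
  (forall k, increasing k -> good le (x \o k)) ->
  exists k, increasing k /\ forall i j, i < j -> le (x (k i)) (x (k j)).
Proof.
move=> gd.
have [p Hp] : exists p, forall n, p <= n -> exists2 m, n < m & le (x n) (x m).
  apply: contrapT => nop.
  have terminal n : exists2 m, n < m & forall l, m < l -> ~ le (x m) (x l).
    apply: contrapT => noq; apply: nop; exists n.+1 => m nm.
    apply: contrapT => noq'; apply: noq; exists m => // l ml leml.
    by apply: noq'; exists l.
  have [k [incr _ Pk]] : exists k, [/\ increasing k, 0 <= k 0
      & forall i, forall l, k i.+1 < l -> ~ le (x (k i.+1)) (x l)].
    apply: (@increasing_choice
      (fun _ m => forall l, m < l -> ~ le (x m) (x l))) => n _; exact: terminal.
  have [i [j [ij]]] := gd (k \o succn) (fun i => incr i.+1).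
  by apply: Pk; apply: (@increasing_ltn k i.+1 j.+1 incr).
have [k [incr _ Pk]] := increasing_choice Hp; exists k; split=> // i j.
elim: j => // j IH; rewrite ltnS leq_eqVlt => /orP[/eqP->//|/IH le1].
exact: le_trans le1 (Pk j).
Qed.

Lemma wqo_monotone (x : nat -> T) : wqo le ->
  exists k, increasing k /\ forall i j, i < j -> le (x (k i)) (x (k j)).
Proof. by move=> w; apply: good_monotone => k _; apply: w. Qed.

End Wqo.

Lemma fin_monotone (T : finType) (x : nat -> T) :
  exists k, increasing k /\ forall i j, i < j -> x (k i) = x (k j).
Proof.
apply: (@wqo_monotone T eq) => [? ? ? -> //|y].
have /injectivePn[i [j neq eqy]] : ~~ injectiveb (fun i : 'I_#|T|.+1 => y i).
  by apply/negP=> /injectiveP/leq_card; rewrite card_ord ltnn.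
wlog ij : i j neq eqy / i < j.
  move=> H; case: (ltngtP i j) => [|ji|/val_inj eqij]; first exact: H.
    by apply: (H j i) => //; rewrite eq_sym.
  by rewrite eqij eqxx in neq.
by exists i, j.
Qed.

(** * Minimal bad sequences and Kruskal's theorem *)

Section MinimalBadSequence.
Variables (T : Type) (size : T -> nat) (le : T -> T -> Prop).

Let bad (x : nat -> T) := ~ good le x.
Let extends (s : seq T) := exists2 x, bad x & mkseq x (seq.size s) = s.

(** Nash-Williams' greedy choice: each term has least size among those that prolong the chosen
    prefix to a prefix of a bad sequence, which is what [extends] records. *)
Lemma minimal_bad_sequence : ~ wqo le ->
  exists2 x, bad x & forall n y, bad y -> (forall i, i < n -> y i = x i) ->
    size (x n) <= size (y n).
Proof.
move=> /existsNP[x0 bad0].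
have [f Hf] : {f : seq T -> T & forall s, extends s -> extends (rcons s (f s)) /\
    forall t, extends (rcons s t) -> size (f s) <= size t}.
  apply: (@choice _ _ (fun s t => extends s -> extends (rcons s t) /\
    forall u, extends (rcons s u) -> size t <= size u)) => s.
  case: (pselect (extends s)) => [[x badx xs]|noext]; last by exists (x0 0).
  pose P n := `[< exists2 t, extends (rcons s t) & size t = n >].
  have exP : exists n, P n.
    exists (size (x (seq.size s))); apply/asboolP; exists (x (seq.size s)) => //.
    by exists x => //; rewrite size_rcons mkseqS xs.
  case: (ex_minnP exP) => n /asboolP[t extt <-] mint; exists t => _; split=> // u extu.
  by apply: mint; apply/asboolP; exists u.
pose x n := f (history f n).
have historyE n : history f n = mkseq x n.
  by elim: n => //= n IH; rewrite mkseqS -IH.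
have ext n : extends (mkseq x n).
  elim: n => [|n IH]; first by exists x0.
  by rewrite mkseqS /x historyE; case: (Hf _ IH).
have eqx n y : mkseq y (seq.size (mkseq x n)) = mkseq x n -> forall i, i < n ->
    y i = x i.
  rewrite size_mkseq => E i ltin.
  by have := congr1 (fun s => nth (x 0) s i) E; rewrite !nth_mkseq.
(* The limit is bad because a good pair at positions i < j would already lie in a prefix of length
   j+1 of some bad sequence. *)
exists x => [[i [j [ij leij]]]|n y bady yx].
  have [y bady /eqx yx] := ext j.+1; apply: bady; exists i, j; split=> //.
  by rewrite !yx // ltnW.
rewrite {1}/x historyE; have [_] := Hf _ (ext n); apply.
exists y => //; rewrite size_rcons size_mkseq mkseqS; congr rcons.
by apply/eq_in_map => i; rewrite mem_iota => /andP[_ /yx].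
Qed.

End MinimalBadSequence.

(* T is a type of labelled binary trees with subtrees l and r; le need only
   contain the homeomorphic embedding. *)
Lemma kruskal_binary (T : Type) (size : T -> nat) (le : T -> T -> Prop)
    (L : finType) (lab : T -> L) (l r : T -> T) :
  (forall x y z, le x y -> le y z -> le x z) ->
  (forall t u, size t = 0 -> le t u) ->
  (forall t, 0 < size t -> size (l t) < size t) ->
  (forall t, 0 < size t -> size (r t) < size t) ->
  (forall t u, 0 < size u -> le t (l u) -> le t u) ->
  (forall t u, 0 < size u -> le t (r u) -> le t u) ->
  (forall t u, 0 < size t -> 0 < size u -> lab t = lab u -> le (l t) (l u) ->
     le (r t) (r u) -> le t u) ->
  wqo le.
Proof.
move=> trans le0 size_l size_r le_l le_r le_node; apply: contrapT.
move=> /(@minimal_bad_sequence T size)[x badx minx].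
have pos i : 0 < size (x i).
  case: posnP => // E; case: badx; exists i, i.+1; split=> //; exact: le0.
(* Were a sequence of subtrees bad, putting it after the first [k 0] terms of [x] would give a bad
   sequence with a smaller term at position [k 0], against minimality. Arbitrary [k] are allowed
   because the right subtrees are later taken along [k1 \o k]. *)
have sub (f : T -> T) : (forall t, 0 < size t -> size (f t) < size t) ->
    (forall t u, 0 < size u -> le t (f u) -> le t u) ->
    forall k, increasing k -> good le ((f \o x) \o k).
  move=> size_f le_f k incr; apply: contrapT => badf.
  pose y i := if i < k 0 then x i else f (x (k (i - k 0))).
  suff bady : ~ good le y.
    have : size (x (k 0)) <= size (y (k 0)).
      by apply: minx => // i ltik; rewrite /y ltik.
    by rewrite /y ltnn subnn leqNgt size_f.
  move=> [i [j [ij]]]; rewrite /y; case: (ltnP j (k 0)) => jk.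
    by rewrite (ltn_trans ij jk) => leij; apply: badx; exists i, j.
  case: (ltnP i (k 0)) => ik leij.
    apply: badx; exists i, (k (j - k 0)); split; last exact: le_f leij.
    apply: leq_trans ik _; case: (j - k 0) => // n.
    exact: ltnW (increasing_ltn incr (ltn0Sn n)).
  by apply: badf; exists (i - k 0), (j - k 0); split=> //; apply: ltn_sub2r => //; lia.
have [k1 [incr1 mono1]] := good_monotone trans (sub l size_l le_l).
have [k2 [incr2 mono2]] : exists k, increasing k /\ forall i j, i < j ->
    le (r (x (k1 (k i)))) (r (x (k1 (k j)))).
  apply: (@good_monotone _ le trans (r \o x \o k1)) => k incr.
  apply: (sub r size_r le_r (k1 \o k)) => i; exact: increasing_ltn incr1 (incr i).
have [k3 [incr3 mono3]] := fin_monotone (lab \o x \o k1 \o k2).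
have lt2 := increasing_ltn incr2 (incr3 0).
apply: badx; exists (k1 (k2 (k3 0))), (k1 (k2 (k3 1))); split.
  exact: increasing_ltn incr1 lt2.
apply: le_node => //; [exact: mono3|exact: mono1|exact: mono2].
Qed.

(* A planar forest with its n vertices numbered in depth-first order; the last
   axiom says that the descendants of a vertex form an interval. Only the
   values below n are relevant. *)
Record forest (L : Type) := Forest {
  fsize : nat;
  flab : nat -> L;
  fanc : rel nat;
  fanc_refl : forall i, i < fsize -> fanc i i;
  fanc_le : forall i j, j < fsize -> fanc i j -> i <= j;
  fanc_trans : forall i j k, k < fsize -> fanc i j -> fanc j k -> fanc i k;
  fanc_convex : forall i j k, k < fsize -> i <= j -> j <= k -> fanc i k -> fanc i j
}.

Section Kruskal.
Variable L : finType.
Implicit Types F G : forest L.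

(** Meets need not be preserved, so this is weaker than homeomorphic embedding; but ancestors are
    also reflected, as the retraction of trees requires. *)
Definition embedding F G (h : nat -> nat) : Prop :=
  [/\ forall i, i < fsize F -> h i < fsize G /\ flab G (h i) = flab F i,
      forall i j, i < j -> j < fsize F -> h i < h j
    & forall i j, i < fsize F -> j < fsize F -> fanc G (h i) (h j) = fanc F i j].

Definition embeds F G : Prop := exists h, embedding F G h.

Lemma embeds_trans F G H : embeds F G -> embeds G H -> embeds F H.
Proof.
move=> [h [hs hm ha]] [k [ks km ka]]; exists (k \o h).
split=> [i /hs[hi <-]|i j ij jF|i j iF jF] /=; first exact: ks.
  by apply: km; [apply: hm|case: (hs j jF)].
by rewrite ka ?ha //; [case: (hs i iF)|case: (hs j jF)].
Qed.

Local Obligation Tactic := idtac.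
(** The truncation lets [n] overshoot: [fsiblings] passes [fsize F] to mean everything from [a]
    on. *)
Program Definition subforest F (a n : nat) : forest L :=
  @Forest L (minn n (fsize F - a)) (fun i => flab F (a + i))
    (fun i j => fanc F (a + i) (a + j)) _ _ _ _.
Next Obligation. by move=> F a n i lt_i; apply: fanc_refl; lia. Qed.
Next Obligation.
move=> F a n i j lt_j anc; rewrite -(leq_add2l a); apply: fanc_le anc; lia.
Qed.
Next Obligation.
move=> F a n i j k lt_k anc1 anc2; apply: fanc_trans anc1 anc2; lia.
Qed.
Next Obligation.
move=> F a n i j k lt_k ij jk anc; apply: fanc_convex anc; lia.
Qed.

Lemma subforest_embeds F a n : embeds (subforest F a n) F.
Proof. by exists (addn a); split=> [i|i j|i j] //= *; first split=> //; lia. Qed.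

(* As descendants are consecutive, this is also their number. *)
Definition fdesc F : nat := \max_(j < fsize F | fanc F 0 j) j.

Lemma fdesc_lt F : 0 < fsize F -> fdesc F < fsize F.
Proof.
move=> pos; rewrite -(prednK pos) ltnS; apply/bigmax_leqP => j _.
by rewrite -ltnS prednK.
Qed.

Lemma fanc0E F j : j < fsize F -> fanc F 0 j = (j <= fdesc F).
Proof.
move=> jF; apply/idP/idP => [anc|].
  exact: (@leq_bigmax_cond _ _ (fun j : 'I__ => j : nat) (Ordinal jF)).
have pos : 0 < fsize F by lia.
have [|k anck eqk] := @eq_bigmax_cond _
    [pred j : 'I_(fsize F) | fanc F 0 j] (fun j => j : nat).
  by apply/card_gt0P; exists (Ordinal pos); apply: fanc_refl.
by rewrite /fdesc -[leqRHS]/(\max_(i in [pred j :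
    'I_(fsize F) | fanc F 0 j]) i) eqk => jk;
  apply: fanc_convex anck.
Qed.

(* The left-child right-sibling encoding of a forest as a binary tree. *)
Definition fchildren F := subforest F 1 (fdesc F).
Definition fsiblings F := subforest F (fdesc F).+1 (fsize F).

Lemma fancS_sibling F i j : i <= fdesc F -> fdesc F < j -> j < fsize F ->
  fanc F i j = false.
Proof.
move=> ic cj jF; apply/negP=> anc.
suff : fanc F 0 j by rewrite fanc0E // leqNgt cj.
by apply: fanc_trans anc; rewrite // fanc0E //; lia.
Qed.

Lemma fanc_gt F i j : j < i -> j < fsize F -> fanc F i j = false.
Proof. by move=> ji jF; apply/negP=> /(fanc_le jF); rewrite leqNgt ji. Qed.

(** The first vertex, its proper descendants and the remaining vertices are consecutive blocks, and
    the only ancestor pairs across blocks lead from the first vertex to its descendants. So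
    embeddings of the two later blocks glue without any compatibility between them. *)
Lemma embeds_node F G : 0 < fsize F -> 0 < fsize G -> flab F 0 = flab G 0 ->
  embeds (fchildren F) (fchildren G) -> embeds (fsiblings F) (fsiblings G) ->
  embeds F G.
Proof.
move=> posF posG lab0 [h [/= hs hm ha]] [k [/= ks km ka]].
have cF := fdesc_lt posF; have cG := fdesc_lt posG.
set c := fdesc F in hs hm ha ks km ka cF *.
set d := fdesc G in hs hm ha ks km ka cG *.
pose f i := if i == 0 then 0 else if i <= c then (h i.-1).+1 else d.+1 + k (i - c.+1).
have lt_h i : i < c -> h i < d by move=> ic; have [] := hs i ltac:(lia); lia.
have lt_k i : i < fsize F - c.+1 -> k i < fsize G - d.+1.
  by move=> ic; have [] := ks i ltac:(lia); lia.
have cases i : i < fsize F -> [\/ i = 0, exists2 j, i = j.+1 & j < c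
    | exists2 j, i = c.+1 + j & j < fsize F - c.+1].
  move=> iF; case: i iF => [|i] iF; first by constructor.
  case: (ltnP i c) => ic; first by constructor 2; exists i.
  by constructor 3; exists (i.+1 - c.+1); lia.
have f0 : f 0 = 0 by [].
have f1 j : j < c -> f j.+1 = (h j).+1 by rewrite /f /= => ->.
have f2 j : f (c.+1 + j) = d.+1 + k j by rewrite /f /= addSn ltnNge leq_addr subSS addKn.
exists f; split.
- move=> i /cases[->|[j -> jc]|[j -> jc]].
  + by rewrite f0.
  + rewrite f1 //; have [_ ] := hs j ltac:(lia); rewrite !add1n => <-; split=> //.
    by have := lt_h j jc; lia.
  + rewrite f2 //; have [_ ->] := ks j ltac:(lia); split=> //.
    by have := lt_k j jc; lia.
- move=> i j ij jF; have iF := ltn_trans ij jF.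
  case: (cases _ iF) ij => [->|[i' -> ic]|[i' -> ic]];
    case: (cases _ jF) => [->|[j' -> jc]|[j' -> jc]] ij; rewrite ?f0 ?f2 ?f1 //;
        try lia.
  + by rewrite ltnS; apply: hm; lia.
  + by have := lt_h _ ic; lia.
  + by rewrite ltn_add2l; apply: km; lia.
- have boundG n : n < fsize F - c.+1 -> d.+1 + k n < fsize G.
    by move/lt_k; rewrite ltn_subRL.
  move=> i j iF jF.
  case: (cases _ iF) => [Ei|[i' Ei ic]|[i' Ei ic]]; rewrite {i}Ei in iF *;
    case: (cases _ jF) => [Ej|[j' Ej jc]|[j' Ej jc]]; rewrite {j}Ej in jF *;
    rewrite ?f0 ?f2 ?f1 //.
  + by rewrite !fanc_refl.
  + have := lt_h _ jc => lt; rewrite !fanc0E -/c -/d ?jc ?lt //; lia.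
  + by rewrite !fanc0E ?boundG // -/c -/d; lia.
  + by have := lt_h _ ic => lt; rewrite !fanc_gt.
  + by have := ha i' j'; rewrite !add1n => -> //; lia.
  + by have := lt_h _ ic => lt; have := boundG _ jc => lt';
      rewrite !fancS_sibling -/c -/d //; lia.
  + by rewrite !fanc_gt.
  + by have := lt_h _ jc => lt; rewrite !fanc_gt //; lia.
  + by apply: ka; lia.
Qed.

Lemma kruskal : wqo embeds.
Proof.
apply: (@kruskal_binary _ (@fsize L) embeds L (fun F => flab F 0) fchildren fsiblings).
- exact: embeds_trans.
- by move=> F G F0; exists id; split=> [i|i j|i j]; rewrite F0 ltn0.
- by move=> F pos /=; have := fdesc_lt pos; lia.
- by move=> F pos /=; have := fdesc_lt pos; lia.
- by move=> F G _ /embeds_trans; apply; apply: subforest_embeds.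
- by move=> F G _ /embeds_trans; apply; apply: subforest_embeds.
- exact: embeds_node.
Qed.

End Kruskal.

(** * Noetherianity of representations of quasi-Groebner categories *)

Lemma finite_subset_seq (T : Type) (A : T -> Prop) :
  finite_subset A <-> exists s : seq T, forall t, A t -> List.In t s.
Proof.
split=> [[n [x Hx]]|[s]].
  exists (map x (enum 'I_n)) => t /Hx[i ->]; apply: List.in_map.
  have: i \in enum 'I_n by rewrite mem_enum.
  by elim: (enum _) => //= j s IH; rewrite inE => /orP[/eqP->|/IH]; [left|right].
elim: s A => [|a s IH] A As;
    first by exists 0, (fun i : 'I_0 => False_rect T (notF (ltn_ord i))) => t /As.
have [n [x Hx]] := IH (fun t => List.In t s) (fun t => id).
exists n.+1, (fun i => oapp x a (unlift ord0 i)) => t /As[->|/Hx[i ->]].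
  by exists ord0; rewrite unlift_none.
by exists (lift ord0 i); rewrite liftK.
Qed.

Section Ideals.
Variable R : comPzRingType.
Local Open Scope ring_scope.

Inductive idl (A : R -> Prop) : R -> Prop :=
| idl0 : idl A 0
| idl_add a r b : A r -> idl A b -> idl A (a * r + b).

Lemma idlD A a b : idl A a -> idl A b -> idl A (a + b).
Proof.
elim=> [|c r d Ar Hd IH] Hb; first by rewrite add0r.
by rewrite -addrA; apply: idl_add => //; apply: IH.
Qed.

Lemma idlM A a b : idl A b -> idl A (a * b).
Proof.
elim=> [|c r d Ar Hd IH]; first by rewrite mulr0; apply: idl0.
by rewrite mulrDr mulrA; apply: idl_add.
Qed.

Lemma idl_gen (A : R -> Prop) a : A a -> idl A a.
Proof. by move=> Aa; rewrite -[a]addr0 -[a]mul1r; apply: idl_add => //;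
    apply: idl0. Qed.

Lemma idl_mono (A B : R -> Prop) a :
  (forall b, A b -> idl B b) -> idl A a -> idl B a.
Proof.
move=> AB; elim=> [|c r d Ar Hd IH]; first exact: idl0.
by apply: idlD => //; apply: idlM; apply: AB.
Qed.

(** The ideal of all the [r i] has finitely many generators. Each lies in the ideal of a finite
    initial segment, so all lie in that of one segment, of length N say, and then so does [r N]. *)
Lemma noetherian_stationary (r : nat -> R) : noetherian_ring R ->
  exists n, idl (fun b => exists2 i, (i < n)%N & b = r i) (r n).
Proof.
move=> noeth; pose J := idl (fun b => exists i, b = r i).
have Jclosed : submod_closed ([pred a : R^o | `[< J a >]] : {pred R^o}).
  split=> [|a u v]; rewrite !inE; first by apply/asboolP; apply: idl0.
  by move=> /asboolP Ju /asboolP Jv; apply/asboolP; apply: idlD => //; apply: idlM.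
have [n [a Ha]] := noeth _ Jclosed.
have fin_stage b : J b -> exists m, idl (fun b => exists2 i, (i < m)%N & b = r i) b.
  elim=> [|c s d [i ->] _ [m IH]]; first by exists 0%N; apply: idl0.
  exists (maxn i.+1 m); apply: idl_add; first by exists i; rewrite ?leq_maxl.
  apply: idl_mono IH => _ [j jm ->]; apply: idl_gen; exists j => //.
  by rewrite leq_max jm orbT.
have {fin_stage}stage (i : 'I_n) :
    exists m, idl (fun b => exists2 i, (i < m)%N & b = r i) (a i).
  apply: fin_stage.
  suff : a i \in ([pred a : R^o | `[< J a >]] : {pred R^o}) by rewrite inE => /asboolP.
  apply/(Ha _); exists (fun j => (j == i)%:R).
  by rewrite (bigD1 i) //= eqxx mul1r big1 ?addr0 // => j /negPf->; rewrite mul0r.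
have [m Hm] := @choice _ _ (fun (i : 'I_n) m =>
  idl (fun b => exists2 i, (i < m)%N & b = r i) (a i)) stage.
pose N := \max_(i < n) m i; exists N.
have : r N \in ([pred a : R^o | `[< J a >]] : {pred R^o}).
  by rewrite inE; apply/asboolP; apply: idl_gen; exists N.
move=> /(Ha _)[c ->]; elim/big_rec: _ => [|i b _]; first exact: idl0.
apply: idlD; apply: idlM; apply: idl_mono (Hm i) => _ [j jm ->].
apply: idl_gen; exists j => //; apply: leq_trans jm _.
exact: (leq_bigmax_cond (F := m)).
Qed.

End Ideals.

(** * Spans and finite generation of representations *)

Section Generation.
Variables (C : category) (R : comPzRingType) (M : representation R C).
Local Open Scope ring_scope.

Definition helt := {c : C & M c}.

(** Closure under scalars and arrows is derived in [spanZ] and [span_map] rather than built in, so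
    that an induction meets only sums of translates of generators. *)
Inductive span (A : forall c, M c -> Prop) : forall c, M c -> Prop :=
| span0 c : span A (0 : M c)
| spanD c (m1 m2 : M c) : span A m1 -> span A m2 -> span A (m1 + m2)
| span_act c c' (h : arrow c c') (r : R) m :
    A c m -> span A (r *: rmap M h m).

Definition listed (s : seq helt) (c : C) (m : M c) : Prop :=
  List.In (existT _ c m) s.

Lemma span_gen A c (m : M c) : A c m -> span A m.
Proof. by move=> Am; rewrite -[m]rmap1 -[rmap _ _ _]scale1r; apply: span_act. Qed.

Lemma spanZ A c r (m : M c) : span A m -> span A (r *: m).
Proof.
elim=> {m}{c} [c|c m1 m2 _ H1 _ H2|c c' h r' m Am].
- by rewrite scaler0; apply: span0.
- by rewrite scalerDr; apply: spanD.
- by rewrite scalerA; apply: span_act.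
Qed.

Lemma span_map A c c' (h : arrow c c') (m : M c) : span A m -> span A (rmap M h m).
Proof.
move=> Hm; elim: Hm c' h => {m}{c} [c|c m1 m2 _ H1 _ H2|c c' h r' m Am] c'' h'.
- by rewrite linear0; apply: span0.
- by rewrite linearD; apply: spanD; [apply: H1|apply: H2].
- by rewrite linearZ -rmapM; apply: span_act.
Qed.

Lemma span_mono (A B : forall c, M c -> Prop) c (m : M c) :
  (forall c m, A c m -> span B m) -> span A m -> span B m.
Proof.
move=> AB; elim=> {m}{c} [c|c m1 m2 _ H1 _ H2|c c' h r' m Am].
- exact: span0.
- exact: spanD.
- by apply: spanZ; apply: span_map; apply: AB.
Qed.

Lemma subrepD (N : subrep M) c (m n : M c) : m \in N c -> n \in N c -> m + n \in N c.
Proof. by move=> Hm Hn; rewrite -[m]scale1r; apply: (subobj_closed N c).2. Qed.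

Lemma subrepZ (N : subrep M) c r (m : M c) : m \in N c -> r *: m \in N c.
Proof.
by move=> Hm; rewrite -[_ *: _]addr0; apply: (subobj_closed N c).2 => //;
  apply: (subobj_closed N c).1.
Qed.

Lemma subrepB (N : subrep M) c (m n : M c) : m \in N c -> n \in N c -> m - n \in N c.
Proof. by move=> Hm Hn; rewrite -scaleN1r; apply: subrepD => //; apply: subrepZ. Qed.

Lemma span_sub (N : subrep M) (A : forall c, M c -> Prop) :
  (forall c m, A c m -> m \in N c) -> forall c (m : M c), span A m -> m \in N c.
Proof.
move=> AN c m; elim=> {m}{c} [c|c m1 m2 _ H1 _ H2|c c' h r' m /AN Nm].
- exact: (subobj_closed N c).1.
- exact: subrepD.
- by apply: subrepZ; apply: subobj_map.
Qed.

Lemma span_closed (A : forall c, M c -> Prop) c :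
  submod_closed ([pred m : M c | `[< span A m >]] : {pred M c}).
Proof.
split=> [|a u v]; rewrite !inE; first by apply/asboolP; apply: span0.
by move=> /asboolP Au /asboolP Av; apply/asboolP; apply: spanD => //; apply: spanZ.
Qed.

Lemma span_subobj_map (A : forall c, M c -> Prop) (x y : C) (h : arrow x y) (m : M x) :
  m \in ([pred m : M x | `[< span A m >]] : {pred M x}) ->
  rmap M h m \in ([pred m : M y | `[< span A m >]] : {pred M y}).
Proof. by rewrite !inE => /asboolP Am; apply/asboolP; apply: span_map. Qed.

Definition span_subrep (A : forall c, M c -> Prop) : subrep M :=
  Subrep (@span_closed A) (@span_subobj_map A).

Lemma span_subrepP A c (m : M c) : m \in span_subrep A c <-> span A m.
Proof. by rewrite inE; split=> /asboolP. Qed.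

Definition hgenerated (N : subrep M) : Prop :=
  exists s : seq helt, (forall c m, listed s m -> m \in N c) /\
    forall c (m : M c), m \in N c -> span (listed s) m.

Definition dirac_fun (c : C) (m : M c) (d : C) : M d :=
  if pselect (c = d) is left E then ecast d (M d) E m else 0.

Lemma dirac_fin (c : C) (m : M c) :
  finite_subset (fun d : C => dirac_fun m d <> 0).
Proof.
exists 1%N, (fun=> c) => d; rewrite /dirac_fun.
by case: pselect => [E _|//]; exists ord0; rewrite E.
Qed.

Definition dirac (c : C) (m : M c) : dsum M := exist _ (dirac_fun m) (dirac_fin m).

Lemma dirac_at (c : C) (m : M c) : sval (dirac m) c = m.
Proof.
rewrite /= /dirac_fun; case: pselect => // E.
by rewrite (Prop_irrelevance E (erefl c)).
Qed.

Lemma dirac_mem (N : subrep M) (c : C) (m : M c) :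
  subrep_mem N (dirac m) <-> m \in N c.
Proof.
split=> [/(_ c)|Nm d]; first by rewrite dirac_at.
rewrite /= /dirac_fun; case: pselect => [E|_]; last exact: (subobj_closed N d).1.
by case: d / E.
Qed.

(** A subrepresentation contains an element of the direct sum when it contains its components, of
    which finitely many are nonzero. So finitely many generators can be traded for finitely many
    homogeneous ones, and [dirac] leads back. *)
Lemma hgeneratedP (N : subrep M) : subrep_finitely_generated N <-> hgenerated N.
Proof.
split=> [[S [/finite_subset_seq[s Ss] [SN least]]]|[s [sN Ns]]].
  have [supp Hsupp] : {supp : dsum M -> seq C &
      forall m c, sval m c <> 0 -> List.In c (supp m)}.
    apply: (@choice _ _ (fun (m : dsum M) t => forall c, sval m c <> 0 -> List.In c t)).
    by move=> m; have /finite_subset_seq[t Ht] := svalP m; exists t.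
  pose S' c (m : M c) := exists m', [/\ S m', List.In c (supp m') & m = sval m' c].
  have [t Ht] : exists t : seq helt, forall c m, S' c m -> listed t m.
    exists (List.flat_map (fun m' => List.map (fun c =>
        existT _ c (sval m' c)) (supp m')) s).
    move=> c m [m' [Sm' cm' ->]]; apply/List.in_flat_map; exists m'.
    by split; [apply: Ss | apply: (List.in_map (fun c => existT _ c (sval m' c)))].
  exists (List.filter (fun x => `[< S' (tag x) (tagged x) >]) t); split.
    move=> c m /List.filter_In[_ /asboolP[m' /= [Sm' _ ->]]]; exact: SN.
  move=> c m /least; move=> /(_ (span_subrep (@S'))) H.
  have {H} /span_subrepP : m \in span_subrep (@S') c.
    apply: H => m' Sm' d; apply/span_subrepP.
    case: (pselect (sval m' d = 0)) => [->|nz]; first exact: span0.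
    by apply: span_gen; exists m'; split=> //; apply: Hsupp.
  apply: span_mono => {m}{}c m Sm; apply: span_gen.
  by apply/List.filter_In; split; [apply: Ht | apply/asboolP].
exists (fun m => exists x : helt, List.In x s /\ m = dirac (tagged x)); split.
  apply/finite_subset_seq; exists (List.map (fun x => dirac (tagged x)) s).
  by move=> _ [x [xs ->]]; apply: (List.in_map (fun x => dirac (tagged x))).
split=> [_ [[c m] [/= xs ->]]|N' SN' c m /Ns]; first by apply/dirac_mem; apply: sN.
apply: span_sub => {m}{}c m ms; apply/dirac_mem.
by apply: SN'; exists (existT _ c m).
Qed.

End Generation.

(** * Leading coefficients relative to one generator *)

Section GroebnerStep.
Variables (C : category) (c0 : C).
Let S := hom_functor c0.
Variable le : forall c : C, rel (S c).
Hypothesis le_wo : forall c, wochoice.well_order (@le c).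
Hypothesis le_mono : forall (c c' : C) (h : arrow c c'),
  strictly_monotone (@le c) (@le c') (@smap C S c c' h).
Hypothesis noeth : noetherian_poset (@poset_le C S).

Variables (R : comPzRingType) (M : representation R C) (x : M c0).
Hypothesis noethR : noetherian_ring R.
Variables B N : subrep M.
Local Open Scope ring_scope.

Definition before {c} (s t : S c) : Prop := le s t /\ s <> t.

Lemma le_min c (A : S c -> Prop) s : A s -> exists2 z, A z & forall t, A t -> le z t.
Proof.
move=> As; have [|z [[Az zmin] _]] := le_wo (A := [pred u : S c | `[< A u >]]) (c := c).
  by exists s; rewrite inE; apply/asboolP.
move: Az; rewrite inE => /asboolP Az; exists z => // t At.
by apply: zmin; rewrite inE; apply/asboolP.
Qed.

(** [well_order] only asserts a unique least element in each nonempty set; the axioms of a total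
    order are read off from sets of at most three elements. *)
Lemma le_total c (s t : S c) : le s t \/ le t s.
Proof.
have [//|z [->|->] zmin] := @le_min c (fun u => u = s \/ u = t) s; first by left.
  by left; apply: zmin; right.
by right; apply: zmin; left.
Qed.

Lemma le_anti c (s t : S c) : le s t -> le t s -> s = t.
Proof.
move=> st ts; have ss : le s s by case: (le_total s s).
have tt : le t t by case: (le_total t t).
have [|z [_ uniq]] := le_wo (A := [pred u : S c | `[< u = s \/ u = t >]]) (c := c).
  by exists s; rewrite inE; apply/asboolP; left.
rewrite -(uniq s); first rewrite -(uniq t) //.
  split; first by rewrite inE; apply/asboolP; right.
  by move=> u; rewrite inE => /asboolP[] ->.
split; first by rewrite inE; apply/asboolP; left.
by move=> u; rewrite inE => /asboolP[] ->.
Qed.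

Lemma le_trans c (s t u : S c) : le s t -> le t u -> le s u.
Proof.
move=> st tu.
have [|z H zmin] := @le_min c (fun v => [\/ v = s, v = t | v = u]) s;
    first by constructor.
have zs := zmin s (Or31 _ _ erefl); have zt := zmin t (Or32 _ _ erefl).
have zu := zmin u (Or33 _ _ erefl).
case: H => E; rewrite {}E in zs zt zu => //.
  by rewrite (le_anti st zs).
by rewrite -(le_anti tu zt).
Qed.

Lemma before_trans c (s t u : S c) : before s t -> before t u -> before s u.
Proof.
move=> [st nst] [tu ntu]; split; first exact: le_trans tu.
by move=> E; subst u; apply: nst; apply: le_anti.
Qed.

Lemma before_ind c (P : S c -> Prop) :
  (forall t, (forall s, before s t -> P s) -> P t) -> forall t, P t.
Proof.
move=> IH t; apply: contrapT => nPt.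
have [z nPz zmin] := @le_min c (fun u => ~ P u) t nPt.
apply: nPz; apply: IH => s [sz ne].
by apply: contrapT => nPs; apply: ne; apply: le_anti => //; apply: zmin.
Qed.

(* Combinations of terms satisfying P, modulo B: the generator x is treated on
   top of the subrepresentation B spanned by the previous ones. *)
Inductive below {c} (P : S c -> Prop) : M c -> Prop :=
| below_base b : b \in B c -> below P b
| below_add r t m : P t -> below P m -> below P (r *: rmap M t x + m).

Lemma belowD c (P : S c -> Prop) m n : below P m -> below P n -> below P (m + n).
Proof.
move=> Hm; elim: Hm n => {m} [b Bb n|r t m Pt Hm IH n Hn].
  elim=> [b' Bb'|r t m Pt Hm IH]; first by apply: below_base; apply: subrepD.
  by rewrite addrCA; apply: below_add.
by rewrite -addrA; apply: below_add => //; apply: IH.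
Qed.

Lemma belowZ c (P : S c -> Prop) r m : below P m -> below P (r *: m).
Proof.
elim=> [b Bb|r' t n Pt Hn IH]; first by apply: below_base; apply: subrepZ.
by rewrite scalerDr scalerA; apply: below_add.
Qed.

Lemma below_sub c (P Q : S c -> Prop) m :
  (forall t, P t -> Q t) -> below P m -> below Q m.
Proof.
by move=> PQ; elim=> [b|r t n /PQ Qt _]; [apply: below_base|apply: below_add].
Qed.

(** Orderability enters here: strict monotonicity keeps earlier terms strictly before the image of
    [t]. *)
Lemma below_map c c' (h : arrow c c') (t : S c) m :
  below (before ^~ t) m -> below (before ^~ (@smap C S c c' h t)) (rmap M h m).
Proof.
elim=> [b Bb|r s n [st ne] Hn IH].
  by apply: below_base; apply: subobj_map.
rewrite linearD linearZ -rmapM; apply: below_add => //.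
exact: (le_mono h st ne).
Qed.

(** A relation, not a function: the translates of [x] may satisfy linear relations, so [n] can have
    several leading terms, and [r] may be 0. *)
Definition leading {c} (t : S c) (r : R) (n : M c) : Prop :=
  below (before ^~ t) (n - r *: rmap M t x).

Lemma below_leading c (P : S c -> Prop) m : below P m ->
  m \in B c \/ exists t r, P t /\ leading t r m.
Proof.
elim=> [b Bb|r t n Pt Hn [Bn|[s [r' [Ps Hs]]]]]; first by left.
  right; exists t, r; split=> //; rewrite /leading addrAC subrr add0r.
  exact: below_base.
right; case: (pselect (s = t)) => [E|ne].
  exists s, (r + r'); split=> //; rewrite /leading E in Hs *.
  by rewrite scalerDl opprD addrACA subrr add0r.
case: (le_total s t) => st.
  exists t, r; split=> //; rewrite /leading addrAC subrr add0r.
  rewrite -[n](subrK (r' *: rmap M s x)) addrC; apply: below_add; first by split.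
  by apply: below_sub Hs => u us; apply: before_trans us _.
exists s, r'; split=> //; rewrite /leading -addrA; apply: below_add => //.
by split=> // E; apply: ne.
Qed.

Record lead := Lead {
  lead_obj : C;
  lead_mono : S lead_obj;
  lead_coef : R;
  lead_elt : M lead_obj;
  lead_mem : lead_elt \in N lead_obj;
  leadP : leading lead_mono lead_coef lead_elt
}.

Definition lead_le (v w : lead) : Prop :=
  exists h : arrow (lead_obj v) (lead_obj w),
    @smap C S _ _ h (lead_mono v) = lead_mono w.

Lemma lead_le_trans u v w : lead_le u v -> lead_le v w -> lead_le u w.
Proof.
by move=> [h Hh] [k Hk]; exists (mcomp k h); rewrite smapM Hh Hk.
Qed.

Lemma lead_wqo : wqo lead_le.
Proof.
move=> w; pose f i : elements S := existT _ (lead_obj (w i)) (lead_mono (w i)).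
have [i [j [ij [a [b [/= ai bj [h Hh]]]]]]] :=
  noeth (fun i => exist _ (elt_class (f i)) (ex_intro _ (f i) erefl)).
exists i, j; split=> //.
case: ai => -[k Hk] _; case: bj => _ [l Hl].
exists (mcomp l (mcomp h k)); rewrite !smapM.
by rewrite -[lead_mono (w j)]/(tagged (f j)) -Hl -Hh -Hk.
Qed.

(** Otherwise leads could be chosen one after another, each with a coefficient outside the ideal of
    the coefficients of the earlier leads that divide it. Along a subsequence increasing for
    divisibility this contradicts [noetherian_stationary]. *)
Lemma lead_basis : exists s : seq lead, forall w, 
  idl (fun r => exists v, [/\ List.In v s,
      lead_le v w & r = lead_coef v]) (lead_coef w).
Proof.
apply: contrapT => nobasis.
have [f Hf] : {f : seq lead -> lead & forall s, ~ idl (fun r => exists v,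
    [/\ List.In v s, lead_le v (f s) & r = lead_coef v]) (lead_coef (f s))}.
  apply: (@choice _ _ (fun s w => ~ idl (fun r => exists v,
    [/\ List.In v s, lead_le v w & r = lead_coef v]) (lead_coef w))) => s.
  apply: contrapT => nos; apply: nobasis; exists s => w.
  by apply: contrapT => now; apply: nos; exists w.
pose w n := f (history f n).
have [k [incr mono]] := wqo_monotone (@lead_le_trans) w lead_wqo.
have [n Hn] := noetherian_stationary (lead_coef \o w \o k) noethR.
case: (Hf (history f (k n))); apply: idl_mono Hn => _ [i ilt ->].
apply: idl_gen; exists (w (k i)); split=> //; last exact: mono.
by apply: history_In; apply: increasing_ltn.
Qed.

(** Division with remainder, by well-founded induction on the leading monomial: translates of basis
    elements cancel the leading term, and what is left lies in [B] or has an earlier leading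
    monomial. *)
Lemma groebner_step : exists s : seq (helt M),
  (forall c m, listed s m -> m \in N c) /\
  forall c m, m \in N c -> below (fun=> True) m ->
    span (fun c n => listed s n \/ n \in N c /\ n \in B c) m.
Proof.
have [s Hs] := lead_basis.
exists (List.map (fun v => existT _ (lead_obj v) (lead_elt v)) s); split.
  have memN y : List.In y (List.map (fun v => existT (fun c => M c)
      (lead_obj v) (lead_elt v)) s) -> tagged y \in N (tag y).
    by move=> /List.in_map_iff[v [<- _]]; apply: lead_mem.
  by move=> c m; apply: memN.
set t := List.map _ _; move=> c.
set G := fun c n => _ \/ _.
have lowspan (P : S c -> Prop) : 
   (forall t, P t -> forall r m, m \in N c -> leading t r m -> span G m) ->
   forall m, m \in N c -> below P m -> span G m.
  move=> HP m Nm /below_leading[Bm|[u [r [Pu lead]]]].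
    by apply: span_gen; right.
  exact: (HP u Pu r).
suff H u : forall r m, m \in N c -> leading u r m -> span G m.
  by apply: lowspan => v _; apply: H.
elim/before_ind: u => u IH r m Nm lead_m.
pose w := Lead Nm lead_m.
have {Hs} := Hs w; rewrite [lead_coef w]/=.
set A := fun r0 => _.
(* Each combination of coefficients of basis elements dividing [u] is the leading coefficient at [u]
   of the same combination of their translates. *)
suff main : forall a, idl A a -> exists n, [/\ span G n, n \in N c & leading u a n].
  move=> /main[n [Gn Nn lead_n]].
  rewrite -[m](subrK n); apply: spanD => //; apply: lowspan IH _ _ _;
      first exact: subrepB.
  have -> : m - n = (m - r *: rmap M u x) - (n - r *: rmap M u x).
    by rewrite opprB addrA subrK.
  by apply: belowD => //; rewrite -scaleN1r; apply: belowZ.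
move=> a; elim=> [|b _ d [v [vs [h /= Hh] ->]] _ [n [Gn Nn lead_n]]].
  exists 0; split; [exact: span0|exact: (subobj_closed N c).1|].
  by rewrite /leading scale0r subr0; apply: below_base; apply: (subobj_closed B c).1.
exists (b *: rmap M h (lead_elt v) + n); split.
- apply: spanD => //; apply: span_act; left.
  exact: (List.in_map (fun v => existT _ (lead_obj v) (lead_elt v))).
- by apply: subrepD => //; apply: subrepZ; apply: subobj_map; apply: lead_mem.
- rewrite /leading scalerDl opprD addrACA; apply: belowD => //.
  rewrite -scalerA -scalerBr; apply: belowZ.
  rewrite -Hh rmapM -linearZ -linearB; apply: below_map; exact: leadP.
Qed.

End GroebnerStep.

(** Induction on [xs]: [groebner_step] treats the head modulo the span of the tail, and what remains
    lies both in [N] and in that span. *)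
Lemma groebner_noetherian (C : category) (R : comPzRingType)
    (M : representation R C) (xs : seq (helt M)) (N : subrep M) :
  groebner C -> noetherian_ring R ->
  exists ys : seq (helt M), (forall c m, listed ys m -> m \in N c) /\
    forall c (m : M c), m \in N c -> span (listed xs) m -> span (listed ys) m.
Proof.
move=> [_ grob] noethR; elim: xs => [|[c0 x] xs [ys [ysN Hys]]].
  by exists [::]; split=> // c m _; apply: span_mono.
have [[le [le_wo le_mono]] noeth] := grob c0.
have [zs [zsN Hzs]] := groebner_step le_wo le_mono noeth x noethR
  (span_subrep (listed xs)) N.
exists (zs ++ ys); split=> [c m /List.in_app_iff[/zsN|/ysN]//|c m Nm Hm].
have /(Hzs _ _ Nm) : below x (span_subrep (listed xs)) (fun=> True) m.
  elim: Hm => {Nm m c}.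
  - by move=> c; apply: below_base; apply/span_subrepP; apply: span0.
  - by move=> c m1 m2 _ H1 _ H2; apply: belowD.
  move=> c c' h r m; suff H (y : helt M) : List.In y (existT _ c0 x :: xs) ->
      forall h : arrow (tag y) c',
      below x (span_subrep (listed xs)) (fun=> True) (rmap M h (tagged y)).
    by move=> Hm; apply: belowZ; apply: (H (existT _ c m)).
  case=> [<-|ys'] {}h.
    rewrite -[rmap _ _ _]addr0 -[rmap _ _ _]scale1r; apply: below_add => //.
    by apply: below_base; apply/span_subrepP; apply: span0.
  apply: below_base; apply/span_subrepP; apply: span_map; apply: span_gen.
  by case: y h ys'.
apply: span_mono => {m Hm}{}c {Nm}m [zm|[Nm /span_subrepP/(Hys _ _ Nm)]].
  by apply: span_gen; apply/List.in_app_iff; left.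
by apply: span_mono => {m Nm}{}c m ym; apply: span_gen; apply/List.in_app_iff; right.
Qed.

(** * Transfer along a functor with property (F) *)

Section Pullback.
Variables (C D : category) (F : functor C D) (R : comPzRingType).

Program Definition pullback (M : representation R D) : representation R C :=
  @Representation R C (fun c => M (F c)) (fun x y h => rmap M (fmap F h)) _ _.
Next Obligation. by rewrite fmap1 rmap1. Qed.
Next Obligation. by rewrite fmapM rmapM. Qed.

Definition pullback_sub (M : representation R D) (N : subrep M) :
    subrep (pullback M) :=
  @Subrep R C (pullback M) (fun c => N (F c)) (fun c => subobj_closed N (F c))
    (fun x y h m Nm => subobj_map (fmap F h) Nm).

(** By property (F) every arrow from the object of a generator to some [F c] passes through one of
    finitely many [delta i], so the images of the generators under the [delta i] suffice. *)
Lemma pullback_generated (M : representation R D) (xs : seq (helt M)) :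
  property_F F ->
  exists ys : seq (helt (pullback M)), forall c (m : pullback M c),
    span (listed xs) (m : M (F c)) -> span (listed ys) m.
Proof.
move=> propF.
suff [ys Hys] : exists ys : seq (helt (pullback M)),
    forall (x : helt M), List.In x xs -> forall c (h : arrow (tag x) (F c)),
      span (listed ys) (rmap M h (tagged x) : pullback M c).
  have step d (m : M d) : span (listed xs) m ->
      forall c (h : arrow d (F c)), span (listed ys) (rmap M h m : pullback M c).
    elim=> {d m} [d c h|d m1 m2 _ H1 _ H2 c h|d d' h r m xm c k].
    - by rewrite linear0; apply: span0.
    - by rewrite linearD; apply: spanD; [apply: H1|apply: H2].
    - by rewrite linearZ -rmapM; apply: spanZ; apply: (Hys _ xm).
  by exists ys => c m Hm; rewrite -[m](rmap1 (r := M)); apply: step.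
elim: xs => [|x xs [ys Hys]]; first by exists [::].
have [n [c [delta Hdelta]]] := propF (tag x).
pose y i : helt (pullback M) := existT _ (c i) (rmap M (delta i) (tagged x)).
exists (map y (enum 'I_n) ++ ys) => x' [<-|x'xs] d h; last first.
  apply: span_mono (Hys _ x'xs d h) => {x' x'xs h}{}d m ym.
  by apply: span_gen; apply/List.in_app_iff; right.
have [i [gamma ->]] := Hdelta d h; rewrite rmapM.
apply: (span_map (M := pullback M) gamma); apply: span_gen.
apply/List.in_app_iff; left; apply: (List.in_map y).
have: i \in enum 'I_n by rewrite mem_enum.
by elim: (enum _) => //= j s IH; rewrite inE => /orP[/eqP->|/IH]; [left|right].
Qed.

End Pullback.

Theorem quasi_groebner_noetherian (D : category) (R : comPzRingType)
    (M : representation R D) (N : subrep M) :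
  quasi_groebner D -> noetherian_ring R -> finitely_generated M ->
  subrep_finitely_generated N.
Proof.
move=> [C [F [grob surjF propF]]] noethR /hgeneratedP[xs [_ Hxs]].
have [ys Hys] := pullback_generated xs propF.
have [zs [zsN Hzs]] := groebner_noetherian ys (pullback_sub F N) grob noethR.
apply/hgeneratedP; pose f (z : helt (pullback F M)) : helt M :=
  existT _ (F (tag z)) (tagged z).
exists (List.map f zs); split=> [|d m Nm].
  suff H (x : helt M) : List.In x (List.map f zs) -> tagged x \in N (tag x).
    by move=> c m; apply: H.
  by move=> /List.in_map_iff[[c m] [<- /zsN]].
(* The element [m] is moved along an isomorphism to an object [F c], expressed there by [zs], and
   moved back. *)
have [c [h [k [_ hk]]]] := surjF d.
have Fm : span (listed zs) (rmap M k m : pullback F M c).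
  apply: Hzs; first exact: subobj_map.
  by apply: Hys; apply: Hxs.
have step c' (n : pullback F M c') : span (listed zs) n ->
    forall d' (l : arrow (F c') d'), span (listed (List.map f zs)) (rmap M l n).
  elim=> {c' n} [c' d' l|c' m1 m2 _ H1 _ H2 d' l|c' c'' l r n zn d' l'].
  - by rewrite linear0; apply: span0.
  - by rewrite linearD; apply: spanD; [apply: H1|apply: H2].
  - rewrite linearZ -rmapM; apply: span_act.
    exact: (List.in_map f _ (existT _ c' n)).
by have := step c _ Fm d h; rewrite -rmapM hk rmap1.
Qed.

(** * Genus and minor morphisms *)

Section Genus.
Variable Q : quiver.
Local Open Scope ring_scope.

Lemma cocycle_boundary (u : 'rV[rat]_#|qvert Q|) (e : qedge Q) :
  (u *m (boundary Q)^T) 0 (enum_rank e) =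
  u 0 (enum_rank (tgt e)) - u 0 (enum_rank (src e)).
Proof.
rewrite mxE.
have sum1 x : \sum_j u 0 j * (x == enum_val j)%:R = u 0 (enum_rank x).
  rewrite (bigD1 (enum_rank x)) //= enum_rankK eqxx mulr1 big1 ?addr0 // => j nj.
  have -> : (x == enum_val j) = false.
    by apply: contraNF nj => /eqP->; rewrite enum_valK.
  by rewrite mulr0.
rewrite -!sum1 -sumrB; apply: eq_bigr => j _.
by rewrite !mxE enum_rankK mulrBr.
Qed.

(** The kernel of the transposed boundary consists of the functions on vertices that agree at the
    two ends of each edge. By connectedness these are the constants, so the boundary has rank one
    less than the number of vertices. *)
Lemma genus_connected : qconnected Q -> (genus Q + #|qvert Q| = #|qedge Q|.+1)%N.
Proof.
move=> [/card_gt0P[x0 _] conn].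
have rkB : \rank (kermx (boundary Q)^T) = 1%N.
  pose v : 'rV[rat]_#|qvert Q| := const_mx 1.
  have v0 : v != 0.
    apply/eqP=> /rowP/(_ (enum_rank x0))/eqP; by rewrite !mxE oner_eq0.
  suff /eqmxP E : (kermx (boundary Q)^T == v)%MS by rewrite E rank_rV v0.
  apply/andP; split; last first.
    apply/sub_kermxP/rowP => i; rewrite -(enum_valK i) cocycle_boundary !mxE.
    by rewrite subrr.
  apply/row_subP => i; set u := row i _.
  have /sub_kermxP uB : (u <= kermx (boundary Q)^T)%MS by apply: row_sub.
  have step x y : adjacent x y -> u 0 (enum_rank x) = u 0 (enum_rank y).
    move=> /existsP[e adj]; have := cocycle_boundary u e.
    rewrite uB mxE => /eqP; rewrite eq_sym subr_eq0 => /eqP.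
    by case/orP: adj => /andP[/eqP-> /eqP->].
  have const x : u 0 (enum_rank x) = u 0 (enum_rank x0).
    have /connectP[p + ->] := conn x0 x.
    elim: p x0 {conn v0 x} => //= y p IH x /andP[/step-> /IH]; exact.
  apply/sub_rVP; exists (u 0 (enum_rank x0)); apply/rowP => j.
  by rewrite [RHS]mxE [v _ _]mxE mulr1 -(enum_valK j) const.
have := rkB; rewrite mxrank_ker mxrank_tr => E.
rewrite /genus mxrank_ker.
have := rank_leq_row (boundary Q); have := rank_leq_col (boundary Q).
lia.
Qed.

End Genus.

Lemma connect_homo (T T' : finType) (e : rel T) (e' : rel T') (h : T -> T') :
  (forall x y, e x y -> connect e' (h x) (h y)) ->
  forall x y, connect e x y -> connect e' (h x) (h y).
Proof.
move=> H x y /connectP[p + ->]; elim: p x => //= z p IH x /andP[/H xz /IH].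
exact: connect_trans.
Qed.

Definition is_vertex (Q : quiver) (c : cell Q) : bool :=
  if c is Some (inl _) then true else false.

Definition joins (Q : quiver) (e : qedge Q) (x y : qvert Q) : bool :=
  ((src e == x) && (tgt e == y)) || ((src e == y) && (tgt e == x)).

Section Fibers.
Variables (Q' Q : quiver) (phi : qedge Q' -> cell Q) (f : qvert Q' -> qvert Q).

Definition contr_adj : rel (qvert Q') := fun x y =>
  [exists e, is_vertex (phi e) && joins e x y].

Lemma contr_adjC x y : contr_adj x y = contr_adj y x.
Proof. by apply: eq_existsb => e; rewrite /joins orbC. Qed.

Lemma contr_connectC x y : connect contr_adj x y = connect contr_adj y x.
Proof. exact: (sym_connect_sym contr_adjC). Qed.

Hypothesis phi_edge : forall e v, phi e = cvert v -> f (src e) = v /\ f (tgt e) = v.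

Lemma contr_adj_eq x y : contr_adj x y -> f x = f y.
Proof.
case/existsP=> e /andP[]; case E: (phi e) => [[v|]|] // _.
by have [fs ft] := phi_edge E; case/orP=> /andP[/eqP<- /eqP<-]; rewrite fs ft.
Qed.

End Fibers.

Section TreeFibers.
Variables (Q' Q : quiver) (phi : cellmap Q' Q) (f : qvert Q' -> qvert Q).
Hypothesis phi_vert : forall x, phi (cvert x) = cvert (f x).
Hypothesis phi_edge : forall e v,
  phi (cedge e) = cvert v -> f (src e) = v /\ f (tgt e) = v.

Let F v := fiber phi v.
Let edge e := phi (cedge e).

Lemma cvert_inj (Qv : quiver) : injective (@cvert Qv).
Proof. by move=> x y []. Qed.

Lemma fiber_vertE v x : (x \in [set x | phi (cvert x) == cvert v]%SET) = (f x == v).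
Proof. by rewrite inE phi_vert (inj_eq (@cvert_inj Q)). Qed.

Lemma fiber_val v (x : qvert (F v)) : f (val x) = v.
Proof. by case: x => x /=; rewrite inE phi_vert => /eqP[]. Qed.

Lemma card_fiber_vert v : #|qvert (F v)| = #|[pred x | f x == v]|.
Proof. by rewrite card_sig; apply: eq_card => x; rewrite -topredE /= inE phi_vert. Qed.

Lemma card_fiber_edge v : #|qedge (F v)| = #|[pred e | edge e == cvert v]|.
Proof.
rewrite card_sig; apply: eq_card => e; rewrite !inE !phi_vert /edge.
case: eqP => //= E; have [-> ->] := phi_edge E; by rewrite eqxx.
Qed.

Lemma fiber_connected : (forall v, qconnected (F v)) <->
  (forall v, exists x, f x = v) /\
  (forall x y, f x = f y -> connect (contr_adj edge) x y).
Proof.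
split=> [conn|[surj conn] v].
  split=> [v|x y fxy].
    by have [/card_gt0P[x _] _] := conn v; exists (val x); apply: fiber_val.
  have xF : x \in [set z | phi (cvert z) == cvert (f x)]%SET by rewrite fiber_vertE.
  have yF : y \in [set z | phi (cvert z) == cvert (f x)]%SET by rewrite fiber_vertE fxy.
  have [_ /(_ (exist _ x xF) (exist _ y yF))] := conn (f x).
  apply: (connect_homo (h := val)) => u w /existsP[e He]; apply: connect1.
  apply/existsP; exists (val e); have /and3P[] := valP e.
  rewrite inE => /eqP; rewrite /edge => -> _ _ /=.
  by move: He; rewrite /joins -!(inj_eq val_inj).
split=> [|x y].
  by have [x fx] := surj v; rewrite card_fiber_vert; apply/card_gt0P; exists x;
      rewrite inE fx.
have /connectP[p] := conn (val x) (val y) (etrans (fiber_val x) (esym (fiber_val y))).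
elim: p x => [x /= _ /val_inj-> //|z p IH x /= /andP[/[dup] adj xz pz] E].
have zF : z \in [set z | phi (cvert z) == cvert v]%SET.
  by rewrite fiber_vertE -(contr_adj_eq phi_edge adj); apply/eqP; exact: fiber_val.
apply: connect_trans (IH (exist _ z zF) pz E); apply: connect1.
move: xz => /existsP[e /andP[]]; rewrite /edge;
    case Ee: (phi (cedge e)) => [[w|]|] // _ He.
have [es et] := phi_edge Ee.
have wv : w = v.
  case/orP: He => /andP[/eqP sx /eqP tz]; [rewrite -es sx|rewrite -et tz];
      exact: fiber_val.
have eF : [&& e \in [set e | phi (cedge e) == cvert v]%SET,
     src e \in [set x | phi (cvert x) == cvert v]%SET &
     tgt e \in [set x | phi (cvert x) == cvert v]%SET].
  by rewrite !inE !phi_vert Ee es et wv eqxx.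
apply/existsP; exists (exist _ e eF).
by move: He; rewrite /joins -!(inj_eq val_inj).
Qed.

Lemma sum_fiber_vert : \sum_v #|[pred x | f x == v]| = #|qvert Q'|.
Proof.
rewrite -sum1_card (partition_big f predT) //=; apply: eq_bigr => v _.
by rewrite -sum1_card; apply: eq_bigl => x; rewrite inE.
Qed.

Lemma sum_fiber_edge :
  \sum_v #|[pred e | edge e == cvert v]| = #|[pred e | is_vertex (edge e)]|.
Proof.
transitivity (\sum_v \sum_(e : qedge Q') (edge e == cvert v : nat)).
  by apply: eq_bigr => v _; rewrite -sum1_card [LHS]big_mkcond;
      apply: eq_bigr => e _; rewrite inE; case: eqP.
rewrite exchange_big -sum1_card [RHS]big_mkcond; apply: eq_bigr => e _ /=.
rewrite inE; case E: (edge e) => [[v|a]|] /=; try by rewrite big1.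
rewrite (bigD1 v) //= eqxx big1 ?addn0 // => w; rewrite eq_sym => /negPf wv.
by rewrite (inj_eq (@cvert_inj Q)) wv.
Qed.

(** Summing [genus_connected] over connected fibers expresses the total genus by the numbers of
    contracted edges and of vertices. Genera being natural numbers, they all vanish as soon as their
    sum does, which is a single global count. *)
Lemma tree_fibers : (forall v, directed_tree (F v)) <->
  [/\ forall v, exists x, f x = v,
      forall x y, f x = f y -> connect (contr_adj edge) x y
    & #|[pred e | is_vertex (edge e)]| + #|qvert Q| = #|qvert Q'|].
Proof.
have count : (forall v, qconnected (F v)) ->
    \sum_v genus (F v) + #|qvert Q'| =
    #|[pred e | is_vertex (edge e)]| + #|qvert Q|.
  move=> conn; rewrite -sum_fiber_vert -sum_fiber_edge -sum1_card -!big_split /=.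
  apply: eq_bigr => v _; rewrite -card_fiber_vert -card_fiber_edge addn1.
  exact: genus_connected.
split=> [tree|[surj conn card]].
  have conn v := (tree v).1.
  have [surj con] := fiber_connected.1 conn.
  by split=> //; rewrite -(count conn) big1 // => v _; apply: (tree v).2.
have con := fiber_connected.2 (conj surj conn).
move=> v; split=> //; have := count con; rewrite card => /eqP.
rewrite -[in eqbRHS](add0n #|qvert Q'|) eqn_add2r sum_nat_eq0.
by move=> /forallP/(_ v)/eqP.
Qed.

End TreeFibers.

(** [mm_conn] and [mm_card] stand for the tree condition on fibers, by [tree_fibers]; in this form
    the condition is easily composed and cancelled. *)
Record minor_maps (G H : quiver) (v : qvert G -> qvert H) (e : qedge G -> cell H) :
    Prop := MinorMaps {
  mm_vertex : forall a x, e a = cvert x -> v (src a) = x /\ v (tgt a) = x;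
  mm_edge : forall a b, e a = cedge b -> v (src a) = src b /\ v (tgt a) = tgt b;
  mm_onto : forall b, exists a, e a = cedge b;
  mm_inj : forall a a' b, e a = cedge b -> e a' = cedge b -> a = a';
  mm_surj : forall y, exists x, v x = y;
  mm_conn : forall x y, v x = v y -> connect (contr_adj e) x y;
  mm_card : #|[pred a | is_vertex (e a)]| + #|qvert H| = #|qvert G|
}.

Lemma minor_mapsP (G H : quiver) (phi : cellmap G H) : minor phi <->
  exists v, [/\ forall x, phi (cvert x) = cvert (v x), phi (star G) = star H
    & minor_maps v (fun a => phi (cedge a))].
Proof.
have in_edges (Q : quiver) (c : cell Q) :
    (c \in edges Q) = if c is Some (inr _) then true else false.
  by apply/imsetP/idP => [[b _ ->]//|]; case: c => [[|b]|] // _; exists b.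
split=> [[vert st edge inj surj tree]|[v [phi_vert phi_star [vertex edge onto inj surj conn card]]]].
  have [v phi_vert] : {v & forall x, phi (cvert x) = cvert (v x)}.
    apply: (@choice _ _ (fun x y => phi (cvert x) = cvert y)) => x.
    have: phi (cvert x) \in vertices H.
      rewrite -vert; apply: imset_f; exact: imset_f.
    by case/imsetP=> y _ ->; exists y.
  have phi_vertex a x : phi (cedge a) = cvert x -> v (src a) = x /\ v (tgt a) = x.
    move=> E; case: (edge a) => [|[y []]|[b []]]; rewrite E // !phi_vert.
    by case=> -> [->] [->].
  exists v; split=> //.
  have [surjv conn card] := (tree_fibers phi_vert phi_vertex).1 tree.
  split=> //.
  - move=> a b E; case: (edge a) => [|[y []]|[b' []]]; rewrite E // !phi_vert.
    by case=> -> [->] [->].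
  - move=> b; have : cedge b \in edges H by rewrite in_edges.
    rewrite -surj => /imsetP[[[x|a]|]]; rewrite inE in_edges ?st ?phi_vert // => _ ->.
    by exists a.
  - move=> a a' b E E'; have [] : cedge a = cedge a'; last by [].
    by apply: inj; rewrite ?inE ?in_edges ?E ?E'.
split=> //.
- apply/setP=> c; apply/imsetP/imsetP => [[_ /imsetP[x _ ->] ->]|[y _ ->]].
    by exists (v x); rewrite ?phi_vert.
  by have [x <-] := surj y; exists (cvert x); rewrite ?phi_vert ?imset_f.
- move=> a; case E: (phi (cedge a)) => [[y|b]|] // _; [left; exists y|right; exists b].
    by have [sa ta] := vertex a y E; rewrite !phi_vert sa ta.
  by have [sa ta] := edge a b E; rewrite !phi_vert sa ta.
- move=> [[x|a]|] [[x'|a']|]; rewrite !inE !in_edges ?phi_vert ?phi_star //.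
  case E: (phi (Some (inr a))) => [[|b]|] // _ _ E'.
  by rewrite (inj a a' b) // -?E' -?E.
- apply/setP=> c; apply/imsetP/idP => [[c']|]; first by rewrite inE => ? ->.
  rewrite in_edges; case: c => [[|b]|] // _; have [a E] := onto b.
  by exists (cedge a); rewrite ?inE ?in_edges E.
- exact/(tree_fibers phi_vert vertex).
Qed.

Definition cell_comp (G K H : quiver) (v : qvert K -> qvert H) (e' : qedge K -> cell H)
    (e : qedge G -> cell K) (a : qedge G) : cell H :=
  match e a with
  | Some (inl x) => cvert (v x)
  | Some (inr b) => e' b
  | None => star H
  end.

Section Composition.
Variables (G K H : quiver).
Variables (c : qvert G -> qvert K) (ce : qedge G -> cell K).
Variables (p : qvert K -> qvert H) (pe : qedge K -> cell H).
Hypothesis c_minor : minor_maps c ce.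

Let fe := cell_comp p pe ce.

(** An edge contracted by the composite is contracted at once or survives to an edge of [K]
    contracted later, and the surviving edges correspond bijectively to the edges of [K]. *)
Lemma card_cell_comp : #|[pred a | is_vertex (fe a)]| =
  #|[pred a | is_vertex (ce a)]| + #|[pred b | is_vertex (pe b)]|.
Proof.
rewrite -!sum1_card ![\sum_(i in _) 1]big_mkcond /=.
have -> : \sum_(b : qedge K) (if b \in [pred b | is_vertex (pe b)] then 1 else 0) =
    \sum_(a : qedge G) \sum_(b : qedge K) ((ce a == cedge b) && is_vertex (pe b) : nat).
  rewrite exchange_big; apply: eq_bigr => b _; rewrite inE.
  have [a E] := mm_onto c_minor b;
      rewrite (bigD1 a) //= E eqxx /= big1 => [|a' /negPf ne].
    by case: is_vertex.
  case: eqP => //= E'; by rewrite (mm_inj c_minor E' E) eqxx in ne.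
rewrite -big_split /=; apply: eq_bigr => a _; rewrite !inE /fe /cell_comp.
case: (ce a) => [[x|b]|] /=; try by rewrite big1.
rewrite (bigD1 b) //= eqxx big1 /= => [|b' /negPf ne]; first by case: is_vertex.
by case: eqP => // -[E]; rewrite E eqxx in ne.
Qed.

Lemma minor_maps_comp : minor_maps p pe -> minor_maps (p \o c) fe.
Proof.
move=> p_minor; split.
- move=> a x; rewrite /fe /cell_comp /=; case E: (ce a) => [[y|b]|] //.
    by case=> <-; have [-> ->] := mm_vertex c_minor E.
  by move=> /(mm_vertex p_minor); have [-> ->] := mm_edge c_minor E.
- move=> a x; rewrite /fe /cell_comp /=; case E: (ce a) => [[y|b]|] //.
  by move=> /(mm_edge p_minor); have [-> ->] := mm_edge c_minor E.
- move=> b; have [k Ek] := mm_onto p_minor b; have [a Ea] := mm_onto c_minor k.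
  by exists a; rewrite /fe /cell_comp Ea.
- move=> a a' b; rewrite /fe /cell_comp; case E: (ce a) => [[|k]|] // Ek.
  case E': (ce a') => [[|k']|] // Ek'; apply: (mm_inj c_minor E).
  by rewrite (mm_inj p_minor Ek Ek').
- move=> y; have [k <-] := mm_surj p_minor y; have [x <-] := mm_surj c_minor k.
  by exists x.
- have lift x y : c x = c y -> connect (contr_adj fe) x y.
    move/(mm_conn c_minor); apply: (connect_homo (h := id)) => {x y} x y.
    case/existsP=> a /andP[va xy]; apply: connect1; apply/existsP; exists a.
    by rewrite xy andbT /fe /cell_comp; case: (ce a) va => [[]|].
  (* A contracted path in [K] is lifted edge by edge, and consecutive lifts are joined inside the
     connected fibers of [c]. *)
  move=> x y /= /(mm_conn p_minor)/connectP[s].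
  elim: s x => [x _ /= E|k s IH x /= /andP[/existsP[b /andP[vb xk]] ps] E].
    exact/lift.
  have [a Ea] := mm_onto c_minor b; have [sa ta] := mm_edge c_minor Ea.
  have step u w : joins a u w -> connect (contr_adj fe) u w.
    move=> uw; apply: connect1; apply/existsP; exists a.
    by rewrite uw andbT /fe /cell_comp Ea.
  case/orP: xk => /andP[/eqP Es /eqP Et].
    apply: connect_trans (lift x (src a) _) _; first by rewrite sa Es.
    apply: connect_trans (step _ (tgt a) _) _; first by rewrite /joins !eqxx.
    by apply: IH; rewrite ta Et.
  apply: connect_trans (lift x (tgt a) _) _; first by rewrite ta Et.
  apply: connect_trans (step _ (src a) _) _; first by rewrite /joins !eqxx orbT.
  by apply: IH; rewrite sa Es.
- by rewrite card_cell_comp -addnA (mm_card p_minor) (mm_card c_minor).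
Qed.

(** This is the source of factorizations: it makes the second factor minor both when deletions are
    split off and in property (F). *)
Lemma minor_maps_cancel : minor_maps (p \o c) fe -> minor_maps p pe.
Proof.
move=> f_minor.
have feE a b : ce a = cedge b -> fe a = pe b by rewrite /fe /cell_comp => ->.
split.
- move=> b x E; have [a Ea] := mm_onto c_minor b; rewrite -(feE a) // in E.
  by have [<- <-] := mm_edge c_minor Ea; have := mm_vertex f_minor E.
- move=> b x E; have [a Ea] := mm_onto c_minor b; rewrite -(feE a) // in E.
  by have [<- <-] := mm_edge c_minor Ea; have := mm_edge f_minor E.
- move=> x; have [a] := mm_onto f_minor x; rewrite /fe /cell_comp.
  by case: (ce a) => [[|b]|] // E; exists b.
- move=> b b' x E E'; have [a Ea] := mm_onto c_minor b;
    have [a' Ea'] := mm_onto c_minor b'.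
  rewrite -(feE a) // in E; rewrite -(feE a') // in E'.
  by move: Ea'; rewrite -(mm_inj f_minor E E') Ea => -[].
- by move=> y; have [x <-] := mm_surj f_minor y; exists (c x).
- move=> x y; have [x' <-] := mm_surj c_minor x; have [y' <-] := mm_surj c_minor y.
  move/(mm_conn f_minor); apply: connect_homo => {x y x' y'} x y /existsP[a /andP[]].
  rewrite /fe /cell_comp; case E: (ce a) => [[z|b]|] // vb xy.
    have [cs ct] := mm_vertex c_minor E.
    by case/orP: xy => /andP[/eqP<- /eqP<-]; rewrite cs ct connect0.
  have [cs ct] := mm_edge c_minor E; apply: connect1; apply/existsP; exists b.
  by rewrite vb /joins -cs -ct; case/orP: xy => /andP[/eqP-> /eqP->];
      rewrite !eqxx ?orbT.
- apply/eqP; rewrite -(eqn_add2l #|[pred a | is_vertex (ce a)]|) addnA.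
  by rewrite -card_cell_comp (mm_card f_minor) (mm_card c_minor).
Qed.

End Composition.

(** * Base minor morphisms *)

(** By [base_minor_maps] and [base_map_base_minor] these data describe exactly the inductive closure
    [base_minor]. *)
Record base_maps (X Y : cone) (v : qvert (base X) -> qvert (base Y))
    (e : qedge (base X) -> cell (base Y)) (s : qvert (base Y) -> qvert (base X)) :
    Prop := BaseMaps {
  bm_minor : minor_maps v e;
  bm_section : cancel s v;
  bm_dir : forall y, cone_dir X (s y) = cone_dir Y y
}.

Definition lift_cell (X : cone) (c : cell (base X)) : cell X :=
  match c with
  | Some (inl x) => @cvert X (Some x)
  | Some (inr b) => cedge (base_edge b)
  | None => star X
  end.

Section BaseMap.
Variables (X Y : cone) (v : qvert (base X) -> qvert (base Y)).
Variables (e : qedge (base X) -> cell (base Y)) (s : qvert (base Y) -> qvert (base X)).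

Definition cone_edge_map (a : qedge X) : cell Y :=
  match a with
  | inl a => lift_cell (e a)
  | inr x => if x == s (v x) then cedge (cone_edge (v x)) else star Y
  end.

(* The cone edge over y that is kept is the one at s y. *)
Definition base_map : cellmap X Y :=
  [ffun c => match c with
   | Some (inl x) => @cvert Y (omap v x)
   | Some (inr a) => cone_edge_map a
   | None => star Y
   end].

Hypothesis vesP : base_maps v e s.
Let mm := bm_minor vesP.

Lemma cone_minor_maps : @minor_maps X Y (omap v) cone_edge_map.
Proof.
have vs := bm_section vesP.
split.
- move=> [a|x] z /=; last by case: ifP.
  case E: (e a) => [[y|b]|] //= [<-].
  by have [-> ->] := mm_vertex mm E.
- move=> [a|x] z /=.
    by case E: (e a) => [[y|b]|] //= [<-]; have [-> ->] := mm_edge mm E.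
  case: eqP => // E [<-] /=; rewrite -(bm_dir vesP) -E.
  by case: (cone_dir X x).
- move=> [b|y].
    by have [a E] := mm_onto mm b; exists (inl a); rewrite /= E.
  by exists (inr (s y)); rewrite /= vs eqxx.
- have inl_edge a z : lift_cell (e a) = cedge z -> exists2 b, z = inl b & e a = cedge b.
    by case: (e a) => [[|b]|] //= [<-]; exists b.
  move=> [a|x] [a'|x'] z /=.
  + by move=> /inl_edge[b -> E] /inl_edge[b' [<-] E']; rewrite (mm_inj mm E E').
  + by move=> /inl_edge[b -> E]; case: ifP.
  + by case: ifP => // _ [<-] /inl_edge[].
  + case: eqP => // E [<-]; case: eqP => // E' [Ev].
    by rewrite E E' Ev.
- move=> [y|]; last by exists None.
  by exists (Some (s y)); rewrite /= vs.
- move=> [x|] [y|] //= [/(mm_conn mm)].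
  apply: (connect_homo (h := Some)) => {x y} x y /existsP[a /andP[va xy]].
  apply: connect1; apply/existsP; exists (inl a); rewrite /joins /=.
  by case: (e a) va => [[]|] //= z _; move: xy; rewrite /joins.
- rewrite !card_option addnS; congr S; rewrite -(mm_card mm); congr addn.
  rewrite -!sum1_card big_sumType /= [X in _ + X]big1 => [|x]; last first.
    by rewrite inE /=; case: ifP.
  by rewrite addn0; apply: eq_bigl => a; rewrite !inE /=; case: (e a) => [[]|].
Qed.

Lemma base_map_minor : minor base_map.
Proof.
apply/minor_mapsP; exists (omap v); split; rewrite ?ffunE //.
  by move=> x; rewrite ffunE.
suff -> : (fun a => base_map (cedge a)) = cone_edge_map by apply: cone_minor_maps.
by apply/funext => a; rewrite ffunE.
Qed.

Lemma base_map_contraction : (forall a, e a <> star _) -> base_contraction base_map.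
Proof.
move=> nodel; split; first exact: base_map_minor.
- by rewrite ffunE.
- by move=> a; rewrite /deleted ffunE /=; case: (e a) (nodel a) => [[]|].
- by move=> x [z]; rewrite ffunE /=; case: ifP.
Qed.

Lemma base_map_deletion : (forall a, ~~ is_vertex (e a)) -> base_deletion base_map.
Proof.
move=> nocontr; split; first exact: base_map_minor.
- by rewrite ffunE.
- move=> [a|x] [z]; rewrite ffunE /=; last by case: ifP.
  by case: (e a) (nocontr a) => [[]|].
move=> x; rewrite /deleted ffunE /=; case: eqP => // ne _; apply: ne.
(* With no contracted edge a connected fiber of [v] is a single vertex, so [x] equals [s (v x)] and
   its cone edge is kept. *)
have /(mm_conn mm)/connectP[[//|y p] /= /andP[/existsP[a]]] : v x = v (s (v x)).
  by rewrite (bm_section vesP).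
by rewrite (negPf (nocontr a)).
Qed.

End BaseMap.

Lemma base_map_comp (X Y Z : cone) v e s v' e' s' :
  @base_maps X Y v e s -> 
  cm_comp (@base_map Y Z v' e' s') (@base_map X Y v e s) =
  base_map (v' \o v) (cell_comp v' e' e) (s \o s').
Proof.
move=> ves; apply/ffunP=> -[[x|[a|x]]|]; rewrite !ffunE //=.
- by case: x.
- by rewrite /cell_comp; case: (e a) => [[]|]; rewrite /= ?ffunE.
- case: (x =P s (v x)) => E /=; last first.
    case: eqP => // E'; case: E.
    by rewrite {1 2}E' (bm_section ves).
  suff -> : (x == s (s' (v' (v x)))) = (v x == s' (v' (v x))) by [].
  by rewrite {1}E (can_eq (bm_section ves)).
Qed.

Lemma base_maps_comp (X Y Z : cone) v e s v' e' s' :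
  @base_maps X Y v e s -> @base_maps Y Z v' e' s' ->
  base_maps (v' \o v) (cell_comp v' e' e) (s \o s').
Proof.
move=> ves ves'; split.
- exact: minor_maps_comp (bm_minor ves) (bm_minor ves').
- by move=> y /=; rewrite (bm_section ves) (bm_section ves').
- by move=> y /=; rewrite (bm_dir ves) (bm_dir ves').
Qed.

(** As no cone edge is contracted, nothing but the cone point lies over the cone point. Hence
    vertices of the base go to vertices of the base, and comparing ends shows that surviving base
    edges become base edges and surviving cone edges become cone edges of the same direction. *)
Lemma minor_base_maps (X Y : cone) (phi : cellmap X Y) : minor phi ->
  phi (cvert (cone_point X)) = cvert (cone_point Y) ->
  (forall x, ~ contracted phi (cone_edge x)) ->
  exists v e s, base_maps v e s /\ phi = base_map v e s.
Proof.
move=> /minor_mapsP[f [phi_vert phi_star fmm]] pt nocontr.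
have fpt : f None = None by have [] := etrans (esym (phi_vert None)) pt.
have noadj x y : contr_adj (fun a => phi (cedge a)) x y -> x != None.
  case/existsP=> -[a|z] /andP[va]; last first.
    case E: (phi _) (nocontr z) va => [[w|]|] // H _.
    by case: H; exists w.
  by rewrite /joins /=; case/orP=> /andP[/eqP Es /eqP Et]; [rewrite -Es|rewrite -Et].
have f_base x : exists y, f (Some x) = Some y.
  case E: (f (Some x)) => [y|]; first by exists y.
  have /(mm_conn fmm)/connectP[[//|y p]] : f None = f (Some x) by rewrite fpt E.
  by move=> /= /andP[/noadj].
have [v Hv] := choice f_base.
have base_edge_at a c : phi (cedge (base_edge a)) = cedge c ->
    exists2 b, c = base_edge b & v (src a) = src b /\ v (tgt a) = tgt b.
  move/(mm_edge fmm); rewrite /= !Hv; case: c => [b|y] /=.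
    by move=> [[sa] [ta]]; exists b.
  by case: (cone_dir Y y) => -[].
have cone_edge_at x c : phi (cedge (cone_edge x)) = cedge c ->
    c = cone_edge (v x) /\ cone_dir X x = cone_dir Y (v x).
  move/(mm_edge fmm); case: c => [b|y] /=.
    by case: (cone_dir X x); rewrite fpt => -[].
  case: (cone_dir X x); case E: (cone_dir Y y); rewrite fpt Hv => -[Es Et] //;
    [case: Et|case: Es] => ->; by rewrite E.
have [s Hs] : {s & forall y, phi (cedge (cone_edge (s y))) = cedge (cone_edge y)}.
  apply: (@choice _ _ (fun y x =>
      phi (cedge (cone_edge x)) = cedge (cone_edge y))) => y.
  have [[a|x] E] := mm_onto fmm (cone_edge y); last by exists x.
  by have [] := base_edge_at a _ E.
have vs : cancel s v by move=> y; have [[]] := cone_edge_at _ _ (Hs y).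
pose e a : cell (base Y) := match phi (cedge (base_edge a)) with
  | Some (inl (Some y)) => cvert y | Some (inr (inl b)) => cedge b | _ => star _ end.
have He a : phi (cedge (base_edge a)) = lift_cell (e a).
  rewrite /e; case E: (phi _) => [[[y|]|[b|y]]|] //=.
    by have [] := mm_vertex fmm E; rewrite /= Hv.
  by have [] := base_edge_at a _ E.
have phiE : phi = base_map v e s.
  apply/ffunP=> -[[[x|]|[a|x]]|]; rewrite ffunE //=.
  - by rewrite -Hv -phi_vert.
  - exact: He.
  - case: (x =P s (v x)) => E; first by rewrite {1}E; apply: Hs.
    case F: (phi _) (nocontr x) => [[w|c]|] // H; first by case: H; exists w.
    case: E; have [Ec _] := cone_edge_at x c F; rewrite Ec in F.
    by have [] := mm_inj fmm F (Hs (v x)).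
exists v, e, s; split=> //; split=> //; last first.
  by move=> y; have [_ ->] := cone_edge_at _ _ (Hs y); rewrite vs.
split.
- move=> a y E; have := He a; rewrite E => /(mm_vertex fmm).
  by rewrite /= !Hv => -[[->] [->]].
- move=> a y E; have := He a; rewrite E => /(mm_edge fmm).
  by rewrite /= !Hv => -[[->] [->]].
- move=> b; have [[a|x] E] := mm_onto fmm (base_edge b).
    by exists a; rewrite /e E.
  by have [] := cone_edge_at x _ E.
- move=> a a' b E E'.
  have := He a; rewrite E => F; have := He a'; rewrite E' => F'.
  by have [] := mm_inj fmm F F'.
- by move=> y; exists (s y).
- move=> x y vxy; have : f (Some x) = f (Some y) by rewrite !Hv vxy.
  move/(mm_conn fmm)/connectP=> [p].
  elim: p x {vxy} => [x _ [->]|[z|] p IH x /= /andP[adj pz] E]; first exact: connect0.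
    apply: connect_trans (IH z pz E); apply: connect1.
    move: adj => /existsP[[a|w] /andP[va xz]]; last first.
      case F: (phi _) (nocontr w) va => [[u|]|] // H _; by case: H; exists u.
    apply/existsP; exists a; move: va xz; rewrite He /joins.
    by case: (e a) => [[]|].
  by rewrite contr_adjC in adj; have := noadj _ _ adj.
- have := mm_card fmm; rewrite !card_option addnS => -[<-]; congr addn.
  rewrite -!sum1_card big_sumType /= [X in _ + X]big1 => [|x]; last first.
    rewrite inE; case F: (phi _) (nocontr x) => [[u|]|] // H _; by case: H; exists u.
  by rewrite addn0; apply: eq_bigl => a; rewrite !inE He; case: (e a) => [[]|].
Qed.

Lemma base_minor_maps (X Y : cone) (phi : cellmap X Y) : base_minor phi ->
  exists v e s, base_maps v e s /\ phi = base_map v e s.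
Proof.
elim=> {X Y phi} [X Y phi [mphi pt _ nocontr]|X Y phi [mphi pt nocontr _]|].
- exact: minor_base_maps.
- by apply: minor_base_maps => // x; apply: nocontr.
- move=> X Y Z psi phi _ [v' [e' [s' [ves' ->]]]] _ [v [e [s [ves ->]]]].
  exists (v' \o v), (cell_comp v' e' e), (s \o s'); split.
    exact: base_maps_comp ves ves'.
  exact: base_map_comp.
Qed.

(* Delete the edges sent to the star first, then contract. *)
Lemma base_map_base_minor (X Y : cone) v e s :
  @base_maps X Y v e s -> base_minor (base_map v e s).
Proof.
move=> ves; pose D := {a : qedge (base X) | e a != star _}.
pose G := @Quiver (qvert (base X)) D (fun a => src (val a)) (fun a => tgt (val a)).
pose Z := @Cone G (cone_dir X).
pose ce a : cell G := if insub a is Some a' then @cedge G a' else star G.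
have ceE a b : ce a = cedge b -> a = val b.
  by rewrite /ce; case: insubP => // u _ <- [<-].
have ce_val (b : qedge G) : ce (val b) = cedge b by rewrite /ce valK.
have nocontr a : ~~ is_vertex (ce a) by rewrite /ce; case: insubP.
have cmm : @base_maps X Z id ce id.
  split=> //; split.
  - by move=> a x E; have := nocontr a; rewrite E.
  - by move=> a b /ceE->.
  - by move=> b; exists (val b).
  - by move=> a a' b /ceE-> /ceE->.
  - by move=> y; exists y.
  - by move=> x y /= ->; apply: connect0.
  - by rewrite eq_card0 // => a; rewrite inE (negPf (nocontr a)).
pose pe (b : qedge G) := e (val b).
have compE : @cell_comp (base X) G (base Y) v pe ce = e.
  apply/funext => a; rewrite /cell_comp /ce; case: insubP => [u _ <- //|].
  by rewrite negbK => /eqP.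
have pmm : @base_maps Z Y v pe s.
  split; [|exact: bm_section ves|exact: bm_dir ves].
  apply: (@minor_maps_cancel (base X) G (base Y) id ce v pe (bm_minor cmm)).
  rewrite compE.
  exact: bm_minor ves.
have -> : base_map v e s = cm_comp (@base_map Z Y v pe s) (@base_map X Z id ce id).
  by rewrite (@base_map_comp X Z Y id ce id v pe s cmm) compE.
apply: Base_comp; first apply: Base_contraction.
  by apply: (@base_map_contraction Z Y v pe s) => // b; apply/eqP; apply: (valP b).
exact: Base_deletion (base_map_deletion cmm nocontr).
Qed.

(** * The category of depth-first ordered trees *)

Lemma ord_val_inj n (i j : 'I_n) : (i : nat) = j -> i = j.
Proof. exact: val_inj. Qed.

Section Trees.
Variable g : nat.

(** Finiteness for each [n] gives essential smallness, through countability of [tree], and the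
    finite families of property (F). Empty slots [None] allow for genus below g, and [n.+1] vertices
    guarantee a root. *)
Definition tree_code (n : nat) : finType :=
  ({ffun 'I_n.+1 * 'I_n.+1 -> bool} * {ffun 'I_n.+1 -> bool * bool} *
   {ffun 'I_g -> option ('I_n.+1 * 'I_n.+1)})%type.

(* c.1.1 is the ancestor relation of a planar rooted tree whose vertices are
   numbered in depth-first order: descendants form an interval. *)
Definition tree_wf (n : nat) (c : tree_code n) : bool :=
  let anc i j := c.1.1 (i, j) in
  [forall i, forall j, forall k, [&& anc i i, anc ord0 i, anc i j ==> (i <= j),
     anc i j && anc j k ==> anc i k & (i <= j <= k) && anc i k ==> anc i j]].

(* The decorations are, for every vertex, the orientations of the edge to its
   parent and of its cone edge, and the ends of the additional edges. *)
Definition tree := {n : nat & {c : tree_code n | tree_wf c}}.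

Definition tvert (T : tree) := 'I_(tag T).+1.
Definition anc (T : tree) (i j : tvert T) : bool := (val (tagged T)).1.1 (i, j).
Definition lab (T : tree) (i : tvert T) : bool * bool := (val (tagged T)).1.2 i.
Definition ext (T : tree) (i : 'I_g) : option (tvert T * tvert T) :=
  (val (tagged T)).2 i.

Section Ancestors.
Variable T : tree.
Implicit Types i j k x y : tvert T.

Lemma tree_axioms i j k : [/\ anc i i, anc ord0 i, anc i j -> i <= j,
  anc i j -> anc j k -> anc i k & i <= j -> j <= k -> anc i k -> anc i j].
Proof.
have := valP (tagged T) => /forallP/(_ i)/forallP/(_ j)/forallP/(_ k)/and5P[].
move=> ? ? /implyP ? /implyP tr /implyP cv; split=> // H1 H2.
  by apply: tr; apply/andP.
by move=> H3; apply: cv; rewrite H1 H2.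
Qed.

Lemma anc_refl i : anc i i. Proof. by case: (tree_axioms i i i). Qed.
Lemma anc0 i : anc ord0 i. Proof. by case: (tree_axioms i i i). Qed.
Lemma anc_le i j : anc i j -> i <= j. Proof. by case: (tree_axioms i j j). Qed.
Lemma anc_trans i j k : anc i j -> anc j k -> anc i k.
Proof. by case: (tree_axioms i j k). Qed.
Lemma anc_convex i j k : i <= j -> j <= k -> anc i k -> anc i j.
Proof. by case: (tree_axioms i j k). Qed.

Lemma anc_anti i j : anc i j -> anc j i -> i = j.
Proof. by move=> /anc_le ij /anc_le ji; apply/ord_val_inj/eqP; rewrite eqn_leq ij. Qed.

Lemma anc_gt i j : j < i -> anc i j = false.
Proof. by move=> ji; apply/negP => /anc_le; rewrite leqNgt ji. Qed.

Definition parent x : tvert T :=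
  [arg max_(y > ord0 | anc y x && (y != x)) (y : nat)].

(** The proper ancestor with the largest number is the closest one: any other lies before it, and
    convexity makes it an ancestor of it. *)
Lemma ancP x y : x != ord0 -> anc y x && (y != x) = anc y (parent x).
Proof.
move=> x0; rewrite /parent; case: arg_maxnP => [|p /andP[px nepx] pmax].
  by rewrite anc0 eq_sym.
apply/andP/idP => [[yx neyx]|yp].
  by apply: (@anc_convex y p x); [apply: pmax; rewrite yx | apply: anc_le |].
split; first exact: anc_trans px.
by apply: contraNneq nepx => E; rewrite (anc_anti px) // -E.
Qed.

Lemma parent_anc x : x != ord0 -> anc (parent x) x.
Proof. by move=> x0; have := anc_refl (parent x); rewrite -ancP // => /andP[]. Qed.

Lemma parent_lt x : x != ord0 -> parent x < x.
Proof.
move=> x0; have := anc_refl (parent x); rewrite -ancP // => /andP[/anc_le le ne].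
by rewrite ltn_neqAle le andbT.
Qed.

Lemma vert_ind (P : tvert T -> Prop) : P ord0 ->
  (forall x, x != ord0 -> P (parent x) -> P x) -> forall x, P x.
Proof.
move=> P0 IH x; have [n] := ubnP x; elim: n x => // n IHn x; rewrite ltnS => xn.
case: (eqVneq x ord0) => [->//|x0]; apply: IH => //; apply: IHn.
exact: leq_trans (parent_lt x0) xn.
Qed.

Definition tree_edge := {x : tvert T | x != ord0}.
Definition mk_tree_edge x (x0 : x != ord0) : tree_edge := exist _ x x0.
Definition ext_edge := {i : 'I_g | ext T i != None}.
Definition mk_ext_edge (i : 'I_g) (i0 : ext T i != None) : ext_edge := exist _ i i0.
Definition ext_ends (i : ext_edge) : tvert T * tvert T :=
  odflt (ord0, ord0) (ext T (val i)).

Definition tree_src (e : tree_edge + ext_edge) : tvert T :=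
  match e with
  | inl x => if (lab (val x)).1 then parent (val x) else val x
  | inr i => (ext_ends i).1
  end.

Definition tree_tgt (e : tree_edge + ext_edge) : tvert T :=
  match e with
  | inl x => if (lab (val x)).1 then val x else parent (val x)
  | inr i => (ext_ends i).2
  end.

Definition tree_quiver : quiver :=
  @Quiver (tvert T) (tree_edge + ext_edge)%type tree_src tree_tgt.

Lemma tree_edge_joins (x : tree_edge) :
  @joins tree_quiver (inl x) (parent (val x)) (val x).
Proof. by rewrite /joins /=; case: ifP; rewrite !eqxx ?orbT. Qed.

Lemma tree_quiver_connected : qconnected tree_quiver.
Proof.
have adjC : connect_sym (@adjacent tree_quiver).
  by apply: sym_connect_sym => x y; apply: eq_existsb => e; rewrite orbC.
have root x : connect (@adjacent tree_quiver) ord0 x.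
  elim/vert_ind: x => [|x x0 IH]; first exact: connect0.
  apply: connect_trans IH _; apply: connect1; apply/existsP;
      exists (inl (mk_tree_edge x0)).
  exact: (tree_edge_joins (mk_tree_edge x0)).
split=> [|x y]; first by rewrite card_ord.
by apply: connect_trans (root y); rewrite adjC.
Qed.

Lemma tree_quiver_genus : genus tree_quiver <= g.
Proof.
have tree_card : #|{: tree_edge}| = tag T.
  by rewrite card_sig; have := cardC1 (ord0 : tvert T); rewrite card_ord.
have ext_card : #|{: ext_edge}| <= g by rewrite card_sig -[leqRHS]card_ord max_card.
have := genus_connected tree_quiver_connected.
rewrite card_sum tree_card card_ord; move: ext_card; move: #|_| => n; lia.
Qed.

Definition tree_cone : cone :=
  @Cone tree_quiver [ffun x : tvert T => (lab x).2].

Definition tree_cone_le : cone_le g :=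
  @ConeLe g tree_cone tree_quiver_connected tree_quiver_genus.

End Ancestors.

(** [emb_root] ensures that every vertex of [U] has an ancestor in the image, so that [retract] has
    a right value everywhere; [emb_ext] also forces empty slots to stay empty. *)
Record tree_emb (T U : tree) (h : {ffun tvert T -> tvert U}) : Prop := TreeEmb {
  emb_mono : forall i j : tvert T, i < j -> h i < h j;
  emb_anc : forall i j, anc (h i) (h j) = anc i j;
  emb_root : h ord0 = ord0;
  emb_lab : forall i, lab (h i) = lab i;
  emb_ext : forall i, ext U i = omap (fun p => (h p.1, h p.2)) (ext T i)
}.

Definition tree_hom (T U : tree) := {h : {ffun tvert T -> tvert U} | tree_emb h}.

Lemma tree_hom_inj (T U : tree) (f h : tree_hom T U) : sval f =1 sval h -> f = h.
Proof.
case: f h => [f Hf] [h Hh] /= /ffunP E; subst h.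
by rewrite (Prop_irrelevance Hf Hh).
Qed.

Lemma tree_emb_id (T : tree) : tree_emb [ffun i : tvert T => i].
Proof.
split=> *; rewrite ?ffunE //; case: ext => //= -[a b] /=; by rewrite !ffunE.
Qed.

Lemma tree_emb_comp (T U W : tree) (h : {ffun tvert U -> tvert W})
    (f : {ffun tvert T -> tvert U}) :
  tree_emb h -> tree_emb f -> tree_emb [ffun i => h (f i)].
Proof.
move=> [hm ha hr hl he] [fm fa fr fl fe]; split=> *; rewrite ?ffunE //.
- by apply: hm; apply: fm.
- by rewrite ha fa.
- by rewrite fr hr.
- by rewrite hl fl.
- by rewrite he fe; case: ext => //= -[a b]; rewrite !ffunE.
Qed.

Definition tree_id (T : tree) : tree_hom T T := exist _ _ (tree_emb_id T).
Definition tree_comp (T U W : tree) (h : tree_hom U W) (f : tree_hom T U) :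
  tree_hom T W := exist _ _ (tree_emb_comp (svalP h) (svalP f)).

Lemma tree_comp1m T U (f : tree_hom T U) : tree_comp (tree_id U) f = f.
Proof. by apply: tree_hom_inj => i; rewrite !ffunE. Qed.

Lemma tree_compm1 T U (f : tree_hom T U) : tree_comp f (tree_id T) = f.
Proof. by apply: tree_hom_inj => i; rewrite !ffunE. Qed.

Lemma tree_compA T U W Z (k : tree_hom W Z) (h : tree_hom U W) (f : tree_hom T U) :
  tree_comp k (tree_comp h f) = tree_comp (tree_comp k h) f.
Proof. by apply: tree_hom_inj => i; rewrite !ffunE. Qed.

Definition Tree : category :=
  @Category tree tree_hom tree_id tree_comp tree_comp1m tree_compm1 tree_compA.

End Trees.

Lemma card_sub_pred (T : finType) (P Q : pred T) :
  #|[pred x : {x | P x} | Q (val x)]| = #|[pred x | P x & Q x]|.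
Proof.
rewrite -(card_image val_inj); apply: eq_card => x; rewrite !inE.
apply/imageP/andP => [[y Qy ->]|[Px Qx]]; first by split; [apply: (valP y)|].
by exists (exist _ x Px).
Qed.

(** * The contraction attached to an embedding of trees *)

Section Retraction.
Variables (g : nat) (T U : tree g) (h : {ffun tvert T -> tvert U}).
Hypothesis emb : tree_emb h.

(* Right adjoint to h for the ancestor orders. *)
Definition retract (x : tvert U) : tvert T :=
  [arg max_(s > ord0 | anc (h s) x) (s : nat)].

Lemma emb_le (s t : tvert T) : s <= t -> h s <= h t.
Proof.
rewrite leq_eqVlt => /orP[/eqP/ord_val_inj->//|/(emb_mono emb)]; exact: ltnW.
Qed.

Lemma emb_inj : injective h.
Proof.
move=> s t st; case: (ltngtP s t) => [/(emb_mono emb)|/(emb_mono emb)|/ord_val_inj//];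
  by rewrite st ltnn.
Qed.

(** If r is the largest vertex with [h r] an ancestor of [x], any other such s satisfies h s <= h r
    <= x, and convexity makes [h s] an ancestor of [h r]; reflection brings this back to [T]. *)
Lemma retractP s x : anc (h s) x = anc s (retract x).
Proof.
rewrite /retract; case: arg_maxnP => [|r rx rmax]; first by rewrite (emb_root emb) anc0.
apply/idP/idP => [sx|]; last by rewrite -(emb_anc emb) => /anc_trans; apply.
rewrite -(emb_anc emb); apply: (anc_convex (k := x)) => //; last exact: anc_le.
by apply: emb_le; apply: rmax.
Qed.

(** The Yoneda principle for the ancestor order: through the adjunction [retractP] it yields the
    identities between retracts, functoriality included. *)
Lemma anc_eq (x y : tvert T) : (forall s, anc s x = anc s y) -> x = y.
Proof. by move=> E; apply: anc_anti; rewrite ?E ?anc_refl // -E anc_refl. Qed.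

Lemma retractK : cancel h retract.
Proof. by move=> s; apply: anc_eq => t; rewrite -retractP (emb_anc emb). Qed.

Lemma emb_eq0 s : (h s == ord0) = (s == ord0).
Proof. by rewrite -(inj_eq emb_inj) (emb_root emb). Qed.

Lemma retract_parent x : x != ord0 -> h (retract x) != x ->
  retract (parent x) = retract x.
Proof.
move=> x0 nx; apply: anc_eq => s; rewrite -!retractP -ancP //.
case E: (anc (h s) x) => //=; apply: contraNneq nx => hs.
by rewrite -hs retractK.
Qed.

Lemma retract_parent_emb s : s != ord0 -> retract (parent (h s)) = parent s.
Proof.
move=> s0; apply: anc_eq => t; rewrite -retractP -!ancP // ?emb_eq0 //.
by rewrite (emb_anc emb) (inj_eq emb_inj).
Qed.

(** The parent edge of a vertex survives exactly when the vertex is in the image of [h]. The default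
    [None] never occurs for an embedding: [retract_edge_spec] has no deleted case. *)
Definition retract_edge (e : qedge (tree_quiver U)) : cell (tree_quiver T) :=
  match e with
  | inl x => if h (retract (val x)) == val x
      then oapp (fun a => @cedge (tree_quiver T) (inl a)) None (insub (retract (val x)))
      else @cvert (tree_quiver T) (retract (val x))
  | inr i => oapp (fun a => @cedge (tree_quiver T) (inr a)) None (insub (val i))
  end.

Lemma emb_ext_None i : (ext U i != None) = (ext T i != None).
Proof. by rewrite (emb_ext emb); case: ext. Qed.

Lemma emb_ext_ends (i : ext_edge U) (j : ext_edge T) : val i = val j ->
  ext_ends i = (h (ext_ends j).1, h (ext_ends j).2).
Proof.
by move=> E; rewrite /ext_ends E (emb_ext emb); case: ext (valP j) => // -[].
Qed.

Lemma retract_edge_tree (x : tree_edge U) (s : tree_edge T) : h (val s) = val x ->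
  retract_edge (inl x) = @cedge (tree_quiver T) (inl s).
Proof. by move=> E; rewrite /= -E retractK eqxx valK. Qed.

Lemma retract_edge_contr (x : tree_edge U) : h (retract (val x)) != val x ->
  retract_edge (inl x) = @cvert (tree_quiver T) (retract (val x)).
Proof. by move=> /= /negPf->. Qed.

Lemma retract_edge_ext (i : ext_edge U) (j : ext_edge T) : val i = val j ->
  retract_edge (inr i) = @cedge (tree_quiver T) (inr j).
Proof. by move=> E; rewrite /= E valK. Qed.

Variant retract_edge_spec (e : qedge (tree_quiver U)) : cell (tree_quiver T) -> Prop :=
| RetractTree x s of e = inl x & h (val s) = val x :
    retract_edge_spec e (@cedge (tree_quiver T) (inl s))
| RetractContr x of e = inl x & h (retract (val x)) != val x :
    retract_edge_spec e (@cvert (tree_quiver T) (retract (val x)))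
| RetractExt i j of e = inr i & val i = val j :
    retract_edge_spec e (@cedge (tree_quiver T) (inr j)).

Lemma retract_edgeP e : retract_edge_spec e (retract_edge e).
Proof.
case: e => [x|i].
  have [E|ne] := eqVneq (h (retract (val x))) (val x); last first.
    by rewrite retract_edge_contr //; apply: RetractContr ne.
  have s0 : retract (val x) != ord0 by rewrite -emb_eq0 E (valP x).
  rewrite (@retract_edge_tree x (mk_tree_edge s0)) //.
  exact: RetractTree.
have j0 : ext T (val i) != None by rewrite -emb_ext_None (valP i).
by rewrite (@retract_edge_ext i (mk_ext_edge j0)) //; apply: RetractExt.
Qed.

Lemma retract_minor_maps :
    @minor_maps (tree_quiver U) (tree_quiver T) retract retract_edge.
Proof.
split.
- move=> e t; case: retract_edgeP => // x -> ne [<-] /=.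
  by case: ifP => _; rewrite ?retract_parent // (valP x).
- move=> e f; case: retract_edgeP => [x s -> hs|//|i j -> ij] [<-] /=.
    rewrite -hs (emb_lab emb).
    by case: ifP => _; rewrite retract_parent_emb ?retractK // (valP s).
  by rewrite (emb_ext_ends ij) /= !retractK.
- move=> [s|j].
    have x0 : h (val s) != ord0 by rewrite emb_eq0 (valP s).
    by exists (inl (mk_tree_edge x0)); apply: retract_edge_tree.
  have i0 : ext U (val j) != None by rewrite emb_ext_None (valP j).
  by exists (inr (mk_ext_edge i0)); apply: retract_edge_ext.
- move=> e e' f; case: retract_edgeP => [x s -> hs|//|i j -> ij] [<-];
    case: retract_edgeP => [x' s' -> hs'|//|i' j' -> ij'] // [E].
    by congr inl; apply: val_inj; rewrite /= -hs -hs' E.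
  by congr inr; apply: val_inj; rewrite /= ij ij' E.
- by move=> s; exists (h s); rewrite retractK.
(* Going up from [x], all parent edges are contracted until the image of [h] is reached, and
   [retract] is constant on the way. So each fiber is joined to one vertex. *)
- have root x : connect (contr_adj retract_edge) (h (retract x)) x.
    elim/vert_ind: x => [|x x0 IH].
      by rewrite -{1}(emb_root emb) retractK (emb_root emb) connect0.
    have [->|ne] := eqVneq (h (retract x)) x; first exact: connect0.
    rewrite -(retract_parent x0 ne); apply: connect_trans IH _; apply: connect1.
    apply/existsP; exists (inl (mk_tree_edge x0)).
    by rewrite retract_edge_contr //= (tree_edge_joins (mk_tree_edge x0)).
  move=> x y xy; apply: connect_trans (root y).
  by rewrite contr_connectC -xy root.
- rewrite !card_ord addnS; congr S.
  (* Contracted edges are the parent edges of the vertices outside the image; the root, which has no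
     parent edge, is in the image. *)
  have -> : #|[pred a | is_vertex (retract_edge a)]| = #|[predC codom h]|.
    rewrite -!sum1_card big_sumType /= [X in _ + X]big1 ?addn0 => [|i]; last first.
      by rewrite inE; case: retract_edgeP => // x.
    rewrite !sum1_card.
    transitivity #|[pred x : tree_edge U | h (retract (val x)) != val x]|.
      apply: eq_card => x; rewrite [RHS]inE.
      rewrite -[LHS]/(is_vertex (retract_edge (inl x))).
      case: (retract_edgeP (inl x)) => [x' s [<-] <-|x' [<-] ->|i j] //.
      by rewrite retractK eqxx.
    rewrite (@card_sub_pred _ (fun x => x != ord0) (fun x => h (retract x) != x));
        apply: eq_card => x; rewrite !inE.
    have -> : (x \in codom h) = (h (retract x) == x).
      apply/codomP/eqP => [[s ->]|<-]; last by exists (retract x).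
      by rewrite retractK.
    case: eqVneq => [->|] //=; rewrite ?andbT //.
    by rewrite -{1}(emb_root emb) retractK (emb_root emb) eqxx.
  have := cardC [in codom h]; rewrite (card_codom emb_inj) !card_ord.
  by rewrite addSn addnC => -[].
Qed.

End Retraction.

Lemma base_map_id (X : cone) : @base_map X X id (@cedge (base X)) id = cm_id X.
Proof. by apply/ffunP=> -[[[x|]|[a|x]]|]; rewrite !ffunE //= eqxx. Qed.

Section ConeFunctor.
Variable g : nat.

Lemma tree_base_maps (T U : tree g) (h : {ffun tvert T -> tvert U}) :
  tree_emb h -> @base_maps (tree_cone U) (tree_cone T) (retract h) (retract_edge h) h.
Proof.
move=> emb; split; [exact: retract_minor_maps|exact: retractK|].
by move=> s; rewrite !ffunE (emb_lab emb).
Qed.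

Definition tree_map (T U : tree g) (h : {ffun tvert T -> tvert U}) :
    cellmap (tree_cone U) (tree_cone T) :=
  @base_map (tree_cone U) (tree_cone T) (retract h) (retract_edge h) h.

Definition cone_fmap (T U : tree g) (h : tree_hom T U) :
    cone_hom (tree_cone_le U) (tree_cone_le T) :=
  exist _ (tree_map (sval h)) (base_map_base_minor (tree_base_maps (svalP h))).

Lemma retract_id (T : tree g) (x : tvert T) : retract [ffun i => i] x = x.
Proof. by have := retractK (tree_emb_id T) x; rewrite ffunE. Qed.

Lemma cone_fmap1 (T : tree g) : cone_fmap (tree_id T) = cone_id (tree_cone_le T).
Proof.
apply: cone_hom_inj; rewrite /= -base_map_id /tree_map.
congr (@base_map (tree_cone T) (tree_cone T) _ _ _).
- by apply/funext => x; rewrite retract_id.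
- apply/funext => -[x|i].
    by rewrite (@retract_edge_tree _ _ _ _ (tree_emb_id T) x x) // ffunE.
  by rewrite (@retract_edge_ext _ _ _ _ i i).
- by apply/funext => x; rewrite ffunE.
Qed.

Lemma retract_comp (T U W : tree g) (h : {ffun tvert U -> tvert W})
    (f : {ffun tvert T -> tvert U}) (x : tvert W) : tree_emb h -> tree_emb f ->
  retract [ffun i => h (f i)] x = retract f (retract h x).
Proof.
move=> embh embf; apply: anc_eq => s.
by rewrite -(retractP (tree_emb_comp embh embf)) ffunE (retractP embh) (retractP embf).
Qed.

Lemma retract_edge_comp (T U W : tree g) (h : {ffun tvert U -> tvert W})
    (f : {ffun tvert T -> tvert U}) e : tree_emb h -> tree_emb f ->
  retract_edge [ffun i => h (f i)] e =
  @cell_comp (tree_quiver W) (tree_quiver U) (tree_quiver T) (retract f)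
    (retract_edge f) (retract_edge h) e.
Proof.
move=> embh embf; rewrite /cell_comp.
case: (retract_edgeP embh) => [x s -> hs|x -> ne|i j -> ij].
- rewrite -[RHS]/(retract_edge f (inl s)).
  have [E|ne] := eqVneq (f (retract f (val s))) (val s).
    have t0 : retract f (val s) != ord0 by rewrite -(emb_eq0 embf) E (valP s).
    rewrite (@retract_edge_tree _ _ _ _ embf _ (mk_tree_edge t0)) //.
    apply: (retract_edge_tree (tree_emb_comp embh embf)).
    by rewrite ffunE -hs /= E.
  rewrite [RHS]retract_edge_contr // retract_edge_contr.
    by rewrite retract_comp // -hs retractK.
  rewrite ffunE retract_comp // -hs (retractK embh).
  by rewrite (inj_eq (emb_inj embh)).
- rewrite -[RHS]/(@cvert (tree_quiver T) (retract f (retract h (val x)))).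
  rewrite retract_edge_contr ?retract_comp //.
  apply: contraNneq ne; rewrite ffunE => <-; by rewrite (retractK embh).
- rewrite -[RHS]/(retract_edge f (inr j)).
  case: (retract_edgeP embf) => // i' k [<-] jk.
  by apply: retract_edge_ext; rewrite ij.
Qed.

Lemma cone_fmapM (T U W : tree g) (h : tree_hom U W) (f : tree_hom T U) :
  cone_fmap (tree_comp h f) = cone_comp (cone_fmap f) (cone_fmap h).
Proof.
case: h f => [h embh] [f embf]; apply: cone_hom_inj => /=.
rewrite /tree_map (base_map_comp _ _ _ (tree_base_maps embh)).
congr (@base_map (tree_cone W) (tree_cone T) _ _ _); apply/funext => x /=.
- exact: retract_comp.
- exact: retract_edge_comp.
- by rewrite ffunE.
Qed.

Definition cone_functor : functor (Tree g) (op (ConeQuiver g)) :=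
  @Functor (Tree g) (op (ConeQuiver g)) (@tree_cone_le g) cone_fmap cone_fmap1
    (fun T U W h f => cone_fmapM h f).

End ConeFunctor.

(** * The category of trees is Groebner *)

Section LexicographicOrder.
Variables n m : nat.
Implicit Types f h k : {ffun 'I_n -> 'I_m}.

Definition lex_lt f h : bool :=
  [exists i, (f i < h i) && [forall j : 'I_n, (j < i) ==> (f j == h j)]].
Definition lex_le f h : bool := (f == h) || lex_lt f h.

Lemma lex_ltP f h : reflect (exists i, f i < h i /\ forall j : 'I_n, j < i -> f j = h j)
  (lex_lt f h).
Proof.
apply: (iffP existsP) => -[i]; [case/andP=> lt /forallP E|case=> lt E]; exists i.
  by split=> // j ji; have /implyP/(_ ji)/eqP := E j.
by rewrite lt; apply/forallP => j; apply/implyP => /E->.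
Qed.

Lemma lex_lt_trans f h k : lex_lt f h -> lex_lt h k -> lex_lt f k.
Proof.
move=> /lex_ltP[i [lti Ei]] /lex_ltP[j [ltj Ej]]; apply/lex_ltP.
case: (ltngtP i j) => ij.
- by exists i; rewrite -Ej //; split=> // l li; rewrite Ei // Ej // (ltn_trans li).
- by exists j; rewrite Ei //; split=> // l lj; rewrite Ei ?Ej // (ltn_trans lj).
- move/ord_val_inj: ij => ij; subst j; exists i; split; first exact: ltn_trans ltj.
  by move=> l li; rewrite Ei ?Ej.
Qed.

Lemma lex_lt_irr f : lex_lt f f = false.
Proof. by apply/lex_ltP => -[i []]; rewrite ltnn. Qed.

Lemma lex_le_trans f h k : lex_le f h -> lex_le h k -> lex_le f k.
Proof.
move=> /orP[/eqP->//|fh] /orP[/eqP<-|hk]; apply/orP; right=> //.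
exact: lex_lt_trans hk.
Qed.

Lemma lex_le_anti f h : lex_le f h -> lex_le h f -> f = h.
Proof.
move=> /orP[/eqP->//|fh] /orP[/eqP->//|hf].
by have := lex_lt_trans fh hf; rewrite lex_lt_irr.
Qed.

Lemma lex_le_total f h : lex_le f h || lex_le h f.
Proof.
rewrite /lex_le; case: eqVneq => //= ne.
have [i0 ne0] : exists i, f i != h i.
  apply/existsP; apply: contraNT ne; rewrite negb_exists => /forallP E.
  by apply/eqP/ffunP => i; apply/eqP; rewrite -[_ == _]negbK; apply: E.
case: (@arg_minnP _ i0 (fun i => f i != h i) (fun i => i : nat) ne0) => i nei imin.
have E (j : 'I_n) : j < i -> f j = h j.
  by move=> ji; apply/eqP; rewrite -[_ == _]negbK; apply/negP => /imin;
      rewrite leqNgt ji.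
case: (ltngtP (f i) (h i)) => lt; last by rewrite (ord_val_inj lt) eqxx in nei.
  by apply/orP; left; apply/lex_ltP; exists i.
by apply/orP; right; apply/lex_ltP; exists i; split=> // j /E.
Qed.

(** The number of maps that are at most [f] strictly increases with [f], so minimizing it over [A]
    gives a least element. *)
Lemma lex_le_min (A : {ffun 'I_n -> 'I_m} -> Prop) f0 : A f0 ->
  exists2 f, A f & forall h, A h -> lex_le f h.
Proof.
move=> A0; pose rank f := #|[pred h | lex_le h f]|.
have [f /asboolP Af fmin] := @arg_minnP _ f0 (fun f => `[< A f >]) rank (asboolT A0).
exists f => // h Ah; have := fmin h (asboolT Ah).
case/orP: (lex_le_total f h) => // hf.
have [->|ne] := eqVneq h f; first by rewrite /lex_le eqxx.
rewrite leqNgt => /negP[]; apply/proper_card/properP; split.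
  by apply/subsetP => k; rewrite !inE => /lex_le_trans; apply.
exists f; rewrite inE; first by rewrite /lex_le eqxx.
by apply: contraNN ne => fh; rewrite (lex_le_anti fh hf).
Qed.

End LexicographicOrder.

Section TreeGroebner.
Variable g : nat.

Lemma tree_orderable (T : Tree g) : orderable (hom_functor T).
Proof.
exists (fun (U : tree g) (f h : tree_hom T U) => lex_le (sval f) (sval h)).
split=> [U|U W [h emb] [f embf] [k embk] /= /orP[/eqP E|/lex_ltP[i [lt E]]] ne].
- apply: wochoice.antisymmetric_well_order => [f h /andP[fh hf]|A [f0 Af0]].
    by apply: tree_hom_inj => i; rewrite (lex_le_anti fh hf).
  pose A' (f : {ffun tvert T -> tvert U}) :=
    exists h : tree_hom T U, sval h = f /\ h \in A.
  have [f [h [<- hA]] hmin] : exists2 f, A' f & forall h, A' h -> lex_le f h.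
    by apply: (@lex_le_min _ _ A' (sval f0)); exists f0.
  by exists h; split=> // k kA; apply: hmin; exists k.
- by case: ne; apply: tree_hom_inj => i /=; rewrite E.
- split; last by move=> /(congr1 sval)/ffunP/(_ i) /=;
    rewrite !ffunE => /(emb_inj emb) fk;
    rewrite fk ltnn in lt.
  apply/orP; right; apply/lex_ltP; exists i; rewrite !ffunE; split.
    exact: (emb_mono emb).
  by move=> j /E; rewrite !ffunE => ->.
Qed.

Section Marked.
Variables (T : tree g).
Let L : finType := ((bool * bool) * option (tvert T))%type.
Variables (U : tree g) (h : tree_hom T U).

Local Obligation Tactic := idtac.
(* The marks force embeddings to commute with the maps from T. *)
Program Definition marked_forest : forest L :=
  @Forest L (tag U).+1
    (fun i => (lab (inord i : tvert U), [pick s | sval h s == inord i]))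
    (fun i j => (i <= j) && anc (inord i : tvert U) (inord j)) _ _ _ _.
Next Obligation. by move=> i _ /=; rewrite leqnn anc_refl. Qed.
Next Obligation. by move=> i j _ /= /andP[]. Qed.
Next Obligation.
move=> i j k _ /= /andP[ij aij] /andP[jk ajk];
    by rewrite (leq_trans ij jk) (anc_trans aij ajk).
Qed.
Next Obligation.
move=> i j k kU /= ij jk /andP[_ ik]; rewrite ij /=.
have [jU iU] := (leq_ltn_trans jk kU, leq_ltn_trans (leq_trans ij jk) kU).
by rewrite (@anc_convex _ _ (inord i) (inord j) (inord k)) ?inordK.
Qed.

End Marked.

(** The mark at [h s] is [s], so an embedding of marked forests sends [h s] to [k s]. The root and
    the additional edges of [U] and [W] come from [T], so they are then preserved although the
    labels do not mention them. *)
Lemma marked_embeds (T U W : tree g) (h : tree_hom T U) (k : tree_hom T W) :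
  embeds (marked_forest h) (marked_forest k) ->
  exists f : tree_hom U W, tree_comp f h = k.
Proof.
case: h k => [h embh] [k embk] [p [/= pP pm pa]].
pose f : {ffun tvert U -> tvert W} := [ffun i : tvert U => inord (p i)].
have fE (i : tvert U) : f i = p i :> nat.
  by rewrite ffunE inordK //; case: (pP i (ltn_ord i)).
have flab (i : tvert U) : lab (f i) = lab i /\
    [pick s | k s == f i] = [pick s | h s == i].
  have [_ [E1 E2]] := pP i (ltn_ord i).
  by move: E1 E2; rewrite inord_val -[inord (p i)]/(inord (p i) :
      tvert W) -fE inord_val.
have fh s : f (h s) = k s.
  have [_] := flab (h s); case: pickP => [t /eqP kt|nok];
      case: pickP => [t' /eqP/(emb_inj embh) ht' [E]|/(_ s)]; rewrite ?eqxx //.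
  by rewrite -kt E ht'.
have embf : tree_emb f.
  split.
  - by move=> i j ij; rewrite !fE; apply: pm.
  - move=> i j; have := pa i j (ltn_ord i) (ltn_ord j); rewrite -!fE !inord_val.
    case: (leqP i j) => ij /=; last first.
      by rewrite !anc_gt // !fE pm.
    suff -> : f i <= f j by [].
    move: ij; rewrite leq_eqVlt => /orP[/eqP/ord_val_inj->//|ij].
    by rewrite !fE ltnW // pm.
  - by rewrite -[in LHS](emb_root embh) fh (emb_root embk).
  - by move=> i; case: (flab i).
  - move=> i; rewrite (emb_ext embk) (emb_ext embh); case: ext => //= -[a b] /=.
    by rewrite !fh.
by exists (exist _ f embf); apply: tree_hom_inj => s; rewrite /= ffunE; apply: fh.
Qed.

Lemma tree_noetherian (T : Tree g) : noetherian_poset (@poset_le _ (hom_functor T)).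
Proof.
move=> x.
have [f Hf] : {f : nat -> elements (hom_functor T) & forall i,
    sval (x i) = elt_class (f i)}.
  by apply: (@choice _ _ (fun i f => sval (x i) = elt_class f)) => i;
      apply: svalP (x i).
have [i [j [ij emb]]] := kruskal (fun i => marked_forest (tagged (f i) : tree_hom _ _)).
exists i, j; split=> //; exists (f i), (f j).
have refl y : elt_class y y.
  by split; exists (id_arrow _); rewrite smap1.
split; rewrite ?Hf //.
by have [h hh] := marked_embeds emb; exists h.
Qed.

(** A default tree for the natural numbers that encode no tree. *)
Definition point_code : tree_code g 0 :=
  ([ffun=> true], [ffun=> (true, true)], [ffun=> None]).

Lemma point_wf : tree_wf point_code.
Proof.
apply/forallP => i; apply/forallP => j; apply/forallP => k.
by rewrite !ffunE /= !ord1 leqnn implybT.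
Qed.

Lemma tree_small : essentially_small (Tree g).
Proof.
pose point : tree g := existT _ 0 (exist (@tree_wf g 0) point_code point_wf).
exists nat, (fun n => odflt point (unpickle n)) => T; exists (pickle T).
by rewrite pickleK; exists (id_arrow T), (id_arrow T); rewrite comp1m.
Qed.

Lemma tree_groebner : groebner (Tree g).
Proof.
split; first exact: tree_small.
by move=> T; split; [exact: tree_orderable|exact: tree_noetherian].
Qed.

End TreeGroebner.

(** * Spanning trees *)

Section DepthFirst.
Variable G : quiver.
Variable r : qvert G.
Hypothesis conn : forall x y : qvert G, connect (@adjacent G) x y.

(* A depth-first numbering pos of a subtree with vertex set S and parent
   function pr: the descendants of u are numbered from pos u to fin u - 1. *)
Record numbering (S : {set qvert G}) (pos fin : qvert G -> nat)
    (pr : qvert G -> qvert G) : Prop := Numbering {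
  num_root : [/\ r \in S, pos r = 0 & fin r = #|S|];
  num_bound : forall u, u \in S -> pos u < fin u /\ fin u <= #|S|;
  num_inj : {in S &, injective pos};
  num_laminar : forall u v, u \in S -> v \in S -> pos u <= pos v -> pos v < fin u ->
    fin v <= fin u;
  num_parent : forall v, v \in S -> v != r ->
    [/\ pr v \in S, adjacent (pr v) v, pos (pr v) < pos v & pos v < fin (pr v)];
  num_closest : forall v w, v \in S -> v != r -> w \in S ->
    pos (pr v) < pos w -> pos w < pos v -> fin w <= pos v
}.

Lemma numbering_root : numbering [set r] (fun=> 0) (fun=> 1) id.
Proof.
split; rewrite ?cards1 ?set11 //.
- by move=> u v /set1P-> /set1P->.
- by move=> v /set1P->; rewrite eqxx.
Qed.

(* The new vertex y is numbered right after its parent x. *)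
Lemma numbering_extend S pos fin pr x y :
  numbering S pos fin pr -> x \in S -> y \notin S -> adjacent x y ->
  exists pos' fin' pr', numbering (y |: S) pos' fin' pr'.
Proof.
move=> [[rS pr0 fr] bound inj laminar parent closest] xS yS xy.
(* Numbers beyond [pos x] move up by one to make room for [y]. An end [fin z] beyond [pos x] moves
   too: either z is [x] or an ancestor of it and its interval gains [y], or the whole interval of z
   comes after [x]. *)
exists (fun z => if z == y then (pos x).+1 else pos z + (pos x < pos z)).
exists (fun z => if z == y then (pos x).+2 else fin z + (pos x < fin z)).
exists (fun z => if z == y then x else pr z).
have neS z : z \in S -> (z == y) = false by move=> zS; apply: contraNF yS => /eqP<-.
have [xb xb'] := bound x xS.
have cardS : #|y |: S| = #|S|.+1 by rewrite cardsU1 yS.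
have shift_lt a b : (a + (pos x < a) < b + (pos x < b)) = (a < b).
  by case: (ltnP (pos x) a); case: (ltnP (pos x) b); lia.
have shift_le a b : (a + (pos x < a) <= b + (pos x < b)) = (a <= b).
  by case: (ltnP (pos x) a); case: (ltnP (pos x) b); lia.
split.
- by rewrite cardS neS // pr0 fr; split; [apply/setU1P; right| |]; lia.
- move=> u; rewrite cardS => /setU1P[->|uS]; first by rewrite eqxx; lia.
  by rewrite neS //; have := bound u uS; lia.
- move=> u v /setU1P[->|uS] /setU1P[->|vS] //; rewrite ?eqxx ?neS //.
  + by have [-> //|] := eqVneq v x; lia.
  + by lia.
  + move=> E; apply: inj => //; apply/eqP.
    by rewrite eqn_leq -(shift_le (pos u)) -(shift_le (pos v)) E !leqnn.
- move=> u v /setU1P[->|uS] /setU1P[->|vS]; rewrite ?eqxx ?neS //.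
  + by case: (ltnP (pos x) (pos v)); lia.
  + by rewrite shift_lt !shift_le; apply: laminar.
- move=> v /setU1P[->|vS] vr; first by rewrite eqxx neS //; split=> //;
    [apply/setU1P; right| |]; lia.
  have [pS adj lt1 lt2] := parent v vS vr; rewrite !neS // !shift_lt; split=> //.
  by apply/setU1P; right.
- move=> v w /setU1P[->|vS] vr /setU1P[->|wS]; rewrite ?eqxx ?(neS x) ?neS //.
  + by rewrite ltnn addn0 ltnS => lt1 lt2; have := leq_ltn_trans lt2 lt1; rewrite ltnn.
  + by case: (parent v vS vr).
  + by rewrite !shift_lt shift_le; apply: closest.
  + by case: (parent v vS vr).
Qed.

(** Only the numbering is depth-first: the tree grows along an arbitrary edge leaving [S], so any
    spanning tree may result and the remaining edges may join any two vertices. *)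
Lemma depth_first_numbering : exists pos fin pr, numbering [set: qvert G] pos fin pr.
Proof.
suff H k : k < #|qvert G| -> exists (S : {set qvert G}) pos fin pr,
    #|S| = k.+1 /\ numbering S pos fin pr.
  have pos : 0 < #|qvert G| by apply/card_gt0P; exists r.
  have [|S [p [f [pr [cardS Hn]]]]] := H #|qvert G|.-1; first by rewrite prednK.
  have -> : [set: qvert G] = S.
    by apply/eqP; rewrite eq_sym eqEcard subsetT cardsT cardS (prednK pos) leqnn.
  by exists p, f, pr.
elim: k => [|k IH] lt.
  exists [set r], (fun=> 0), (fun=> 1), id.
  by split; [exact: cards1|exact: numbering_root].
have [S [p [f [pr [cardS Hn]]]]] := IH (ltnW lt).
have [rS _ _] := num_root Hn.
have [x [y [xS yS xy]]] : exists x y, [/\ x \in S, y \notin S & adjacent x y].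
  apply: contrapT => none; have : #|S| = #|qvert G|.
    apply: eq_card => z; rewrite [RHS]inE.
    have /connectP[s] := conn r z;
        elim: s r rS => [a aS _ -> //|b s IHs a aS /= /andP[ab ps] E].
    apply: IHs ps E; apply: contrapT => /negP bS; apply: none; by exists a, b.
  by move=> E; rewrite -E cardS ltnn in lt.
have [p' [f' [pr' Hn']]] := numbering_extend Hn xS yS xy.
by exists (y |: S), p', f', pr'; rewrite cardsU1 yS cardS.
Qed.

End DepthFirst.

Lemma iso_minor_maps (G H : quiver) (v : qvert G -> qvert H) (e : qedge G -> qedge H) :
  bijective v -> bijective e -> (forall a, src (e a) = v (src a)) ->
  (forall a, tgt (e a) = v (tgt a)) -> minor_maps v (fun a => cedge (e a)).
Proof.
move=> [v' vK v'K] [e' eK e'K] esrc etgt; split=> //.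
- by move=> a b [<-]; rewrite esrc etgt.
- by move=> b; exists (e' b); rewrite e'K.
- by move=> a a' b [<-] [/(can_inj eK)].
- by move=> y; exists (v' y).
- by move=> x y /(can_inj vK)->; apply: connect0.
- by rewrite eq_card0 // (bij_eq_card (Bijective vK v'K)).
Qed.

Lemma cone_isomorphic (g : nat) (X Y : ConeQuiver g)
    (v : qvert (base (cone_of X)) -> qvert (base (cone_of Y)))
    (e : qedge (base (cone_of X)) -> qedge (base (cone_of Y))) :
  bijective v -> bijective e -> (forall a, src (e a) = v (src a)) ->
  (forall a, tgt (e a) = v (tgt a)) ->
  (forall x, cone_dir (cone_of Y) (v x) = cone_dir (cone_of X) x) ->
  @isomorphic (op (ConeQuiver g)) X Y.
Proof.
move=> [v' vK v'K] [e' eK e'K] esrc etgt vdir.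
have vb : bijective v by exists v'.
have eb : bijective e by exists e'.
have vb' : bijective v' by exists v.
have eb' : bijective e' by exists e.
have esrc' b : src (e' b) = v' (src b) by rewrite -{2}[b]e'K esrc vK.
have etgt' b : tgt (e' b) = v' (tgt b) by rewrite -{2}[b]e'K etgt vK.
have bm : @base_maps (cone_of X) (cone_of Y) v (fun a => cedge (e a)) v'.
  split=> //; first exact: iso_minor_maps.
  by move=> y; rewrite -vdir v'K.
have bm' : @base_maps (cone_of Y) (cone_of X) v' (fun a => cedge (e' a)) v.
  by split=> //; exact: iso_minor_maps.
exists (exist _ _ (base_map_base_minor bm')), (exist _ _ (base_map_base_minor bm)).
split; apply: cone_hom_inj; rewrite /= base_map_comp // -base_map_id.
  congr base_map; apply/funext => x /=; rewrite ?vK //.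
  by rewrite /cell_comp /= eK.
congr base_map; apply/funext => x /=; rewrite ?v'K //.
by rewrite /cell_comp /= e'K.
Qed.

(** * The tree of a cone with numbered base *)

Section TreeOfCone.
Variables (g : nat) (X : cone_le g).
Let G := base (cone_of X).
Let n := #|qvert G|.-1.
Variables (r : qvert G) (pos fin : qvert G -> nat) (pr : qvert G -> qvert G).
Hypothesis num : numbering r [set: qvert G] pos fin pr.

Let cardG : #|qvert G| = n.+1.
Proof. by rewrite prednK //; apply/card_gt0P; exists r. Qed.

Let index (x : qvert G) : 'I_n.+1 := inord (pos x).

Let indexE x : index x = pos x :> nat.
Proof.
have [lt le] := num_bound num (in_setT x).
by rewrite inordK // -cardG -cardsT (leq_trans lt).
Qed.

Let index_inj : injective index.
Proof. by move=> x y /(congr1 val); rewrite /= !indexE; apply: (num_inj num). Qed.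

Let index_bij : bijective index.
Proof. by apply: inj_card_bij; rewrite // cardG card_ord. Qed.

Let vtx_exists : exists vtx, cancel index vtx /\ cancel vtx index.
Proof. by case: index_bij => vtx ? ?; exists vtx. Qed.
Let vtx := projT1 (cid vtx_exists).
Let indexK : cancel index vtx. Proof. by case: (projT2 (cid vtx_exists)). Qed.
Let vtxK : cancel vtx index. Proof. by case: (projT2 (cid vtx_exists)). Qed.

Let pos_vtx i : pos (vtx i) = i. Proof. by rewrite -indexE vtxK. Qed.

Let vtx0 : vtx ord0 = r.
Proof.
apply: index_inj; rewrite vtxK; apply/ord_val_inj; rewrite indexE.
by have [_ ->] := num_root num.
Qed.

Let nonroot := {x : qvert G | x != r}.

Let te_exists : exists te : nonroot -> qedge G,
  forall x, joins (te x) (pr (val x)) (val x).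
Proof.
suff [te Hte] : {te : nonroot -> qedge G & forall x, joins (te x) (pr (val x)) (val x)}.
  by exists te.
apply: (@choice _ _ (fun (x : nonroot) e => joins e (pr (val x)) (val x))) => x.
have [_ /existsP[e He] _ _] := num_parent num (in_setT (val x)) (valP x).
by exists e.
Qed.
Let te := projT1 (cid te_exists).
Let teP x : joins (te x) (pr (val x)) (val x). Proof. exact: (projT2 (cid te_exists)). Qed.

Let pr_lt (x : nonroot) : pos (pr (val x)) < pos (val x).
Proof. by have [] := num_parent num (in_setT (val x)) (valP x). Qed.

(** Two distinct vertices with the same edge to the parent would be parents of each other, while
    parents have smaller numbers. *)
Let te_inj : injective te.
Proof.
move=> x y E; apply: val_inj.
have ltx := pr_lt x; have lty := pr_lt y.
case/orP: (teP x) => /andP[/eqP sx /eqP tx];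
    case/orP: (teP y) => /andP[/eqP sy /eqP ty];
  rewrite E in sx tx.
- by rewrite -tx -ty.
- have E1 : pr (val x) = val y by rewrite -sx sy.
  have E2 : pr (val y) = val x by rewrite -ty tx.
  by rewrite E1 E2 in ltx lty; lia.
- have E1 : pr (val x) = val y by rewrite -tx ty.
  have E2 : pr (val y) = val x by rewrite -sy sx.
  by rewrite E1 E2 in ltx lty; lia.
- by rewrite -sx -sy.
Qed.

Let extra := [predC codom te].

Let card_extra : #|extra| <= g.
Proof.
have := cardC [in codom te]; rewrite card_codom; last exact: te_inj.
have -> : #|{: nonroot}| = n.
  by rewrite card_sig -[RHS]/(n.+1.-1) -cardG -(cardC1 r); apply: eq_card.
have := genus_connected (cone_le_connected X); have := cone_le_genus X.
rewrite -/G cardG; have -> : #|[predC [in codom te]]| = #|extra| by apply: eq_card.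
lia.
Qed.

(** The value [true] at the root is a dummy orientation, as there is no parent edge. The extra edges
    fill the first slots in the order of [enum extra], and the others stay empty. *)
Let code : tree_code g n :=
  ([ffun p : 'I_n.+1 * 'I_n.+1 => (p.1 <= p.2) && (p.2 < fin (vtx p.1))],
   [ffun i : 'I_n.+1 => (if insub (vtx i) is Some x then src (te x) == pr (vtx i) else true,
               cone_dir (cone_of X) (vtx i))],
   [ffun i : 'I_g => omap (fun e => (index (src e), index (tgt e)))
     (ohead (drop i (enum extra)))]).

Let code_wf : tree_wf code.
Proof.
have lam (i j : 'I_n.+1) : i <= j -> j < fin (vtx i) -> fin (vtx j) <= fin (vtx i).
  by move=> ij jf; apply: (num_laminar num); rewrite ?inE ?pos_vtx.
have bound (i : 'I_n.+1) : i < fin (vtx i).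
  by have [] := num_bound num (in_setT (vtx i)); rewrite pos_vtx.
apply/forallP => i; apply/forallP => j; apply/forallP => k.
rewrite !ffunE /= leqnn bound vtx0; have [_ _ ->] := num_root num.
rewrite cardsT cardG ltn_ord /=; apply/and3P; split.
- by apply/implyP => /andP[].
- apply/implyP => /andP[/andP[ij jf] /andP[jk kf]].
  rewrite (leq_trans ij jk) (leq_trans kf) //; exact: lam.
- apply/implyP => /andP[/andP[ij jk] /andP[_ kf]].
  by rewrite ij (leq_ltn_trans jk kf).
Qed.

Let T : tree g := existT _ n (exist (@tree_wf g n) code code_wf).

Let ancE (i j : tvert T) : anc i j = (i <= j) && (j < fin (vtx i)).
Proof. by rewrite /anc /= ffunE. Qed.

Let labE (i : tvert T) : lab i =
  (if insub (vtx i) is Some x then src (te x) == pr (vtx i) else true,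
   cone_dir (cone_of X) (vtx i)).
Proof. by rewrite /lab /= ffunE. Qed.

Let extE i : ext T i = omap (fun e => (index (src e), index (tgt e)))
  (ohead (drop i (enum extra))).
Proof. by rewrite /ext /= ffunE. Qed.

Let vtx_neq (x : tvert T) : (vtx x != r) = (x != ord0).
Proof. by rewrite -vtx0 (can_eq vtxK). Qed.

(** By [num_closest] a vertex numbered strictly between [pr v] and [v] has its interval end before
    [v], so it is no ancestor of [v]. *)
Let parentE (x : tvert T) : x != ord0 -> vtx (parent x) = pr (vtx x).
Proof.
move=> x0; have vr : vtx x != r by rewrite vtx_neq.
have [_ _ lt1 lt2] := num_parent num (in_setT (vtx x)) vr.
rewrite pos_vtx in lt1 lt2.
suff -> : parent x = (index (pr (vtx x)) : tvert T) by rewrite indexK.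
apply: anc_anti; first rewrite ancE.
  have := parent_anc x0; rewrite ancE => /andP[px xf].
  have pltx := parent_lt x0; rewrite indexE.
  have le : parent x <= pos (pr (vtx x)).
    rewrite leqNgt; apply/negP => gt.
    have := num_closest num (in_setT (vtx x)) vr (in_setT (vtx (parent x))).
    by rewrite !pos_vtx => /(_ gt pltx); rewrite leqNgt xf.
  by rewrite le (ltn_trans lt1 xf).
have : anc (index (pr (vtx x)) : tvert T) x && (index (pr (vtx x)) != x).
  rewrite ancE indexE indexK lt2 (ltnW lt1) /=.
  by apply: contraTneq lt1 => E; rewrite -indexE E ltnn.
by rewrite ancP // ancE.
Qed.

Let tree_nonroot (x : tree_edge T) : nonroot :=
  exist _ (vtx (val x)) (etrans (vtx_neq (val x)) (valP x)).

Let ee_exists : exists ee : ext_edge T -> qedge G,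
  forall i : ext_edge T, ohead (drop (val i) (enum extra)) = Some (ee i).
Proof.
suff [ee Hee] : {ee : ext_edge T -> qedge G &
    forall i : ext_edge T,
        ohead (drop (val i) (enum extra)) = Some (ee i)} by exists ee.
apply: (@choice _ _ (fun (i : ext_edge T) e =>
    ohead (drop (val i) (enum extra)) = Some e)) => i.
by have := valP i; rewrite /= extE; case: ohead => // e _; exists e.
Qed.
Let ee := projT1 (cid ee_exists).
Let eeP (i : ext_edge T) : ohead (drop (val i) (enum extra)) = Some (ee i).
Proof. exact: (projT2 (cid ee_exists)). Qed.

Let edge_map (a : qedge (tree_quiver T)) : qedge G :=
  match a with inl x => te (tree_nonroot x) | inr i => ee i end.

Let ee_nth (i : ext_edge T) : (val i :
    nat) = seq.index (ee i) (enum extra) /\ ee i \in extra.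
Proof.
have := eeP i; case: (ltnP (val i) (size (enum extra))) => [lt|ge]; last first.
  by rewrite drop_oversize.
rewrite (drop_nth (ee i)) //= => -[E].
by rewrite -{1}E index_uniq ?enum_uniq // -E -mem_enum mem_nth.
Qed.

Let edge_map_bij : bijective edge_map.
Proof.
have inj : injective edge_map.
  move=> [x|i] [y|j] /= E.
  - have /(congr1 val)/= /(can_inj vtxK) E' := te_inj E.
    by congr inl; apply: val_inj.
  - have [_] := ee_nth j; rewrite -E !inE.
    by rewrite codom_f.
  - have [_] := ee_nth i; rewrite E !inE.
    by rewrite codom_f.
  - congr inr; apply: val_inj; apply: val_inj => /=.
    by have [-> _] := ee_nth i; have [-> _] := ee_nth j; rewrite E.
have surj b : exists a, edge_map a = b.
  case: (boolP (b \in codom te)) => [/codomP[x ->]|bextra].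
    have x0 : (index (val x) : tvert T) != ord0 by rewrite -vtx_neq indexK (valP x).
    exists (inl (mk_tree_edge x0)) => /=; congr te; apply: val_inj => /=.
    by rewrite indexK.
  have lt : seq.index b (enum extra) < size (enum extra) by rewrite index_mem mem_enum.
  have ltg : seq.index b (enum extra) < g by rewrite (leq_trans lt) // -cardE card_extra.
  have Eb : ohead (drop (Ordinal ltg) (enum extra)) = Some b.
    by rewrite (drop_nth b) //= nth_index // mem_enum.
  have i0 : ext T (Ordinal ltg) != None by rewrite extE Eb.
  exists (inr (mk_ext_edge i0)) => /=.
  by have := eeP (mk_ext_edge i0); rewrite /= Eb => -[].
have [k Hk] := choice surj; exists k => // a; apply: inj; exact: Hk.
Qed.

Let te_ends (x : tree_edge T) :
  src (te (tree_nonroot x)) = vtx (tree_src (inl x)) /\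
  tgt (te (tree_nonroot x)) = vtx (tree_tgt (inl x)).
Proof.
rewrite /= labE -[vtx (val x)]/(val (tree_nonroot x)) valK.
have pe : vtx (parent (val x)) = pr (vtx (val x)) by apply: parentE; apply: (valP x).
have lt := pr_lt (tree_nonroot x).
case/orP: (teP (tree_nonroot x)) => /andP[/eqP -> /eqP ->] /=; first by rewrite eqxx pe.
by case: eqP => [E|]; [rewrite -E ltnn in lt|rewrite pe].
Qed.

Lemma numbered_cone_tree : exists T : tree g,
    @isomorphic (op (ConeQuiver g)) (tree_cone_le T) X.
Proof.
exists T; apply: (@cone_isomorphic g (tree_cone_le T) X vtx edge_map).
- by exists index.
- exact: edge_map_bij.
- move=> [x|i]; first by case: (te_ends x).
  by rewrite /= /ext_ends extE eeP /= indexK.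
- move=> [x|i]; first by case: (te_ends x).
  by rewrite /= /ext_ends extE eeP /= indexK.
- by move=> x; rewrite /= ffunE labE.
Qed.

End TreeOfCone.

Lemma cone_functor_surjective (g : nat) : essentially_surjective (cone_functor g).
Proof.
move=> X; have [/card_gt0P[r _] conn] := cone_le_connected X.
have [pos [fin [pr num]]] := depth_first_numbering r conn.
exact: numbered_cone_tree num.
Qed.

(** * Property (F) *)

Section InducedTree.
Variables (g : nat) (T : tree g) (K : {set tvert T}).
Hypothesis root_K : ord0 \in K.
Hypothesis ext_K : forall i p, ext T i = Some p -> p.1 \in K /\ p.2 \in K.

Let m := #|K|.-1.
Let incl (i : 'I_m.+1) : tvert T := nth ord0 (enum K) i.
Let rank (x : tvert T) : 'I_m.+1 := inord (index x (enum K)).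

Let card_K : #|K| = m.+1.
Proof. by rewrite prednK //; apply/card_gt0P; exists ord0. Qed.

Let size_K : size (enum K) = m.+1. Proof. by rewrite -cardE card_K. Qed.

Let rankK x : x \in K -> incl (rank x) = x.
Proof.
by move=> xK; rewrite /incl inordK ?nth_index ?mem_enum // -size_K index_mem mem_enum.
Qed.

Let incl_mono (i j : 'I_m.+1) : i < j -> incl i < incl j.
Proof.
move=> ij; have sortedK : sorted (fun x y : tvert T => x < y) (enum K).
  apply: (subseq_sorted _ (filter_subseq _ _)); first by move=> ? ? ?; apply: ltn_trans.
  by have := iota_ltn_sorted 0 (tag T).+1; rewrite -val_enum_ord -enumT sorted_map.
apply: (sorted_ltn_nth _ _ sortedK) => //; rewrite ?inE ?size_K //.
by move=> ? ? ?; apply: ltn_trans.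
Qed.

Let incl_root : incl ord0 = ord0.
Proof.
case: (posnP (rank ord0)) => [r0|pos].
  by rewrite -[RHS](rankK root_K); congr incl; apply/esym/ord_val_inj.
have := @incl_mono ord0 (rank ord0) pos; by rewrite rankK.
Qed.

Let code : tree_code g m :=
  ([ffun p : 'I_m.+1 * 'I_m.+1 => anc (incl p.1) (incl p.2)],
   [ffun i => lab (incl i)],
   [ffun i => omap (fun p => (rank p.1, rank p.2)) (ext T i)]).

Let incl_le (i j : 'I_m.+1) : i <= j -> incl i <= incl j.
Proof. by rewrite leq_eqVlt => /orP[/eqP/ord_val_inj->//|/incl_mono/ltnW]. Qed.

Let code_wf : tree_wf code.
Proof.
apply/forallP => i; apply/forallP => j; apply/forallP => k.
rewrite !ffunE /= incl_root anc_refl anc0 /=; apply/and3P; split.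
- by apply/implyP => /anc_le; apply: contraTT; rewrite -!ltnNge; apply: incl_mono.
- by apply/implyP => /andP[]; apply: anc_trans.
- by apply/implyP => /andP[/andP[/incl_le ij /incl_le jk]]; apply: anc_convex.
Qed.

(** The tree axioms are universal statements, so they survive restriction to a set containing the
    root, renumbered increasingly. *)
Lemma induced_subtree : exists (S : tree g) (h : {ffun tvert S -> tvert T}),
  [/\ tag S = #|K|.-1, tree_emb h & forall x, x \in K -> exists s, h s = x].
Proof.
exists (existT _ m (exist (@tree_wf g m) code code_wf)), [ffun i => incl i].
split=> //; last by move=> x xK; exists (rank x); rewrite ffunE rankK.
split.
- by move=> i j; rewrite !ffunE; apply: incl_mono.
- by move=> i j; rewrite !ffunE /anc /= ffunE.
- by rewrite ffunE incl_root.
- by move=> i; rewrite ffunE /lab /= ffunE.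
- move=> i; rewrite [in RHS]/ext /= ffunE.
  case E: (ext T i) => [[a b]|] //=; have [aK bK] := ext_K E.
  by rewrite !ffunE !rankK.
Qed.

End InducedTree.

Section Factorization.
Variables (g : nat) (T : tree g) (Y : cone_le g).
Let H := base (cone_of Y).
Variables (v : tvert T -> qvert H) (e : qedge (tree_quiver T) -> cell H)
  (s : qvert H -> tvert T).
Hypothesis ves : @base_maps (tree_cone T) (cone_of Y) v e s.

(* The vertices that must survive for the map to factor: the root, the children
   at tree edges that are not contracted, the ends of the additional edges, and
   the vertices whose cone edge is kept. *)
Let essential : {set tvert T} :=
  ord0 |: [set val x | x in [pred x : tree_edge T | ~~ is_vertex (e (inl x))]]
  :|: [set (ext_ends i).1 | i in [set: ext_edge T]]
  :|: [set (ext_ends i).2 | i in [set: ext_edge T]]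
  :|: [set s y | y in [set: qvert H]].

(** One root, at most g + |V(Y)| - 1 tree edges that are not contracted, 2g ends of additional edges
    and |V(Y)| kept cone edges, where V(Y) is the vertex set of the base of [Y]. The second bound
    compares the edge count from the genus with [mm_card]. *)
Let card_essential : #|essential| <= 3 * g + 2 * #|qvert H|.
Proof.
have ext_card : #|{: ext_edge T}| <= g by rewrite card_sig -[leqRHS]card_ord max_card.
have im_card (f : ext_edge T -> tvert T) : #|[set f i | i in [set: ext_edge T]]| <= g.
  by rewrite (leq_trans (leq_imset_card _ _)) // cardsT.
have s_card : #|[set s y | y in [set: qvert H]]| <= #|qvert H|.
  by rewrite (leq_trans (leq_imset_card _ _)) // cardsT.
have tree_card : #|[set val x | x in [pred x :
    tree_edge T | ~~ is_vertex (e (inl x))]]|.+1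
    <= g + #|qvert H|.
  rewrite card_imset; last exact: val_inj.
  have le : #|[pred x : tree_edge T | ~~ is_vertex (e (inl x))]| <=
      #|[predC [pred a | is_vertex (e a)]]|.
    rewrite -(card_image (@inl_inj _ (ext_edge T))); apply/subset_leq_card/subsetP => a.
    by case/imageP => x; rewrite !inE => ex ->.
  have cardE : genus (tree_quiver T) + (tag T).+1 = #|qedge (tree_quiver T)|.+1.
    by have := genus_connected (tree_quiver_connected T); rewrite card_ord.
  have cardV : #|[pred a | is_vertex (e a)]| + #|qvert H| = (tag T).+1.
    by have := mm_card (bm_minor ves); rewrite card_ord.
  have cardD : #|[pred a | is_vertex (e a)]| + #|[predC [pred a | is_vertex (e a)]]| =
    #|qedge (tree_quiver T)| := cardC _.
  have posH : 0 < #|qvert H| by have [] := cone_le_connected Y.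
  apply: leq_ltn_trans le _; have := tree_quiver_genus T.
  move: cardE cardV cardD; move: #|qedge (tree_quiver T)| #|[predC _]| => a b; lia.
have cardU (A B : {set tvert T}) a b : #|A| <= a -> #|B| <= b -> #|A :|: B| <= a + b.
  by move=> Aa Bb; apply: leq_trans (leq_add Aa Bb); apply: leq_card_setU.
apply: (@leq_trans (g + #|qvert H| + g + g + #|qvert H|)); last by lia.
do 3! (apply: (cardU _ _ _ _); last by []).
by rewrite cardsU1; case: (_ \notin _) => //=; apply: leq_trans tree_card.
Qed.

(** Retracting onto the tree induced on [essential] contracts only edges that the given map
    contracts; the map then descends, and [minor_maps_cancel] makes the quotient minor. *)
Lemma tree_map_factor : exists (S : tree g) (h : tree_hom S T)
    (psi : cone_hom (tree_cone_le S) Y),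
  tag S < (3 * g + 2 * #|qvert H|).+1 /\
  @base_map (tree_cone T) (cone_of Y) v e s = cm_comp (sval psi) (tree_map (sval h)).
Proof.
have ext_ess i p : ext T i = Some p -> p.1 \in essential /\ p.2 \in essential.
  move=> E; have i0 : ext T i != None by rewrite E.
  have <- : ext_ends (mk_ext_edge i0) = p by rewrite /ext_ends /= E.
  by split; rewrite !inE; apply/orP; left; [apply/orP; left|]; apply/orP; right;
      apply: imset_f.
have [|S [h [tagS emb im]]] := induced_subtree _ ext_ess; first by rewrite !inE eqxx.
have codomE x : x \in essential -> h (retract h x) = x.
  by move=> /im[t <-]; rewrite (retractK emb).
have contr x : h (retract h (val x)) != val x -> is_vertex (e (inl x)).
  apply: contraNT => nv; apply/eqP/codomE; rewrite !inE.
  do 3! (apply/orP; left); apply/orP; right; apply: imset_f; exact: nv.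
have contr_val (x : tree_edge T) y : e (inl x) = cvert y ->
    v (val x) = y /\ v (parent (val x)) = y.
  by move=> /(mm_vertex (bm_minor ves)) /=; case: ifP => _ [].
(* A vertex outside the image has a contracted parent edge, so [v] takes the same value at its
   parent, which has the same retract. *)
have vE x : v (h (retract h x)) = v x.
  elim/vert_ind: x => [|x x0 IH].
    by rewrite codomE // !inE eqxx.
  have [->//|ne] := eqVneq (h (retract h x)) x.
  have := @contr (mk_tree_edge x0) ne; case E: (e _) => [[y|]|] // _.
  have [/= vx vp] := contr_val _ _ E.
  by rewrite -(retract_parent emb x0 ne) IH vp vx.
have ext_lift (j : ext_edge S) : ext T (val j) != None.
  by rewrite (emb_ext_None emb) (valP j).
have tree_lift (t : tree_edge S) : h (val t) != ord0.
  by rewrite (emb_eq0 emb) (valP t).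
pose pv t := v (h t).
pose pe (a : qedge (tree_quiver S)) : cell H := match a with
  | inl t => e (inl (mk_tree_edge (tree_lift t)))
  | inr j => e (inr (mk_ext_edge (ext_lift j))) end.
pose ps y := retract h (s y).
have vcomp : pv \o retract h = v by apply/funext => x; apply: vE.
have ecomp : @cell_comp (tree_quiver T) (tree_quiver S) H pv pe (retract_edge h) = e.
  apply/funext => a; rewrite /cell_comp.
  case: (retract_edgeP emb a) => [x t -> hx|x -> ne|i j -> ij].
  - by rewrite /pe; congr (e (inl _)); apply: val_inj.
  - have := contr x ne; case E: (e _) => [[y|]|] // _.
    rewrite -[LHS]/(@cvert H (v (h (retract h (val x))))) vE.
    by have [-> _] := contr_val _ _ E.
  - by rewrite /pe; congr (e (inr _)); apply: val_inj.
have scomp y : h (ps y) = s y.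
  by apply: codomE; rewrite !inE; apply/orP; right; apply: imset_f.
have hm := tree_base_maps emb.
have pes : @base_maps (tree_cone S) (cone_of Y) pv pe ps.
  split.
  - apply: (@minor_maps_cancel (tree_quiver T) (tree_quiver S) H _ _ pv pe (bm_minor hm)).
    by rewrite vcomp ecomp; apply: bm_minor ves.
  - by move=> y; rewrite /pv scomp (bm_section ves).
  - by move=> y; rewrite -(bm_dir hm) scomp (bm_dir ves).
exists S, (exist _ h emb), (exist _ _ (base_map_base_minor pes)); split.
  rewrite ltnS tagS; apply: leq_trans card_essential; exact: leq_pred.
rewrite /= /tree_map (@base_map_comp (tree_cone T) (tree_cone S) (cone_of Y) _ _ _ _ _ _ hm).
by rewrite vcomp ecomp; congr base_map; apply/funext => y; rewrite /= scomp.
Qed.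

End Factorization.

(** There are finitely many trees with at most N vertices and finitely many cell maps from their
    cones to [Y], so all base minor morphisms among these can serve as the family [delta]. *)
Lemma cone_functor_F (g : nat) : property_F (cone_functor g).
Proof.
move=> Y; pose N := (3 * g + 2 * #|qvert (base (cone_of Y))|).+1.
pose Z := {n : 'I_N & {c : tree_code g n | tree_wf c}}.
pose tree_of (z : Z) : tree g := existT _ (tag z : nat) (tagged z).
pose P (p : {z : Z & cellmap (tree_cone (tree_of z)) (cone_of Y)}) :=
    `[< base_minor (tagged p) >].
pose I := {p | P p}.
exists #|{: I}|, (fun i => tree_of (tag (val (enum_val i : I)))).
exists (fun i => exist _ (tagged (val (enum_val i :
    I))) (asboolW (valP (enum_val i : I)))).
move=> T [phi base_phi].
have [v [e [s [ves Ephi]]]] := base_minor_maps base_phi.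
have [[n c] [h [[psi base_psi] [/= ltN Ecomp]]]] := tree_map_factor ves.
pose z : Z := existT _ (Ordinal ltN) c.
pose p : {z : Z & cellmap (tree_cone (tree_of z)) (cone_of Y)} := existT _ z psi.
have Pp : P p by apply/asboolP.
exists (enum_rank (exist _ p Pp : I)).
rewrite enum_rankK; exists h; apply: cone_hom_inj.
by rewrite /= Ephi Ecomp.
Qed.

Theorem proposition3p10 (g : nat) :
  quasi_groebner (op (ConeQuiver g)) /\
  (forall R : comPzRingType, noetherian_ring R ->
     forall M : representation R (op (ConeQuiver g)), finitely_generated M ->
       forall N : subrep M, subrep_finitely_generated N).
Proof.
have qgrob : quasi_groebner (op (ConeQuiver g)).
  exists (Tree g), (cone_functor g); split.
  - exact: tree_groebner.
  - exact: cone_functor_surjective.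
  - exact: cone_functor_F.
split=> // R noethR M fgM N; exact: quasi_groebner_noetherian.
Qed.
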